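(* For every uncountable range set $R$, all the following spaces are $R$-petaloid. (1) The space $(\mathrm{C}_0(\Gamma,R),\triangledown)$ of all continuous functions $f$ from the Cantor set $\Gamma$ into the space $R$ equipped with the nearly discrete topology such that $0\in f(\Gamma)$. (2) The ultrametric space $(\mathrm{Cpu}(X,R),\mathcal{UD}_X^R)$ of all $R$-valued continuous pseudo-ultrametrics on $X$, where $X$ is any compact ultrametrizable space with an accumulation point. (3) The non-Archimedean Gromov--Hausdorff space $(\mathscr{U}_R,\mathcal{NA})$ associated with $R$. (4) The space $(\mathrm{G}(R,\omega_0),\vartriangle)$ of all maps $f:R\to\omega_0$ for which $f(0)=0$ and the support of $f$ is tenuous (i.e. $\{0\}\cup\{x\in R\mid f(x)\ne0\}$ is tenuous), where $\omega_0$ is the set of all non-negative integers.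
   Context: Spaces. Write $a\lor b=\max\{a,b\}$. (1) The nearly discrete metric $M_R$ on a range set $R$ is $M_R(x,y)=x\lor y$ if $x\ne y$ and $M_R(x,x)=0$; its topology is the nearly discrete topology. $\mathrm{C}_0(\Gamma,R)$ is the set of all continuous maps $f:\Gamma\to(R,M_R)$ with $0\in f(\Gamma)$, and $\triangledown(f,g)$ is the infimum of all $\epsilon\in(0,\infty)$ such that $f(x)\le g(x)\lor\epsilon$ and $g(x)\le f(x)\lor\epsilon$ for all $x\in\Gamma$. (2) A pseudo-ultrametric is a pseudo-metric satisfying $d(x,y)\le d(x,z)\lor d(z,y)$; it is $R$-valued if all its values lie in $R$. $\mathrm{Cpu}(X,R)$ is the set of all $R$-valued pseudo-ultrametrics $d:X\times X\to R$ that are continuous with respect to the product topology on $X\times X$ and the Euclidean topology on $R$. $\mathcal{UD}_X^R(d,e)$ is the infimum of all $\epsilon\in R$ such that $d(x,y)\le e(x,y)\lor\epsilon$ and $e(x,y)\le d(x,y)\lor\epsilon$ for all $x,y\in X$. (3) $\mathscr{U}_R$ is the set of all isometry classes of (non-empty) compact $R$-valued ultrametric spaces, and $\mathcal{NA}((X,d),(Y,e))$ is the infimum of all Hausdorff distances, computed in $(Z,h)$, between $i(X)$ and $j(Y)$, where $(Z,h)$ ranges over $R$-valued ultrametric spaces and $i:X\to Z$, $j:Y\to Z$ over isometric embeddings. (4) $\vartriangle(f,g)=\max\{r\in R\mid f(r)\ne g(r)\}$ if $f\ne g$, and $\vartriangle(f,f)=0$. Petaloid spaces. A range set is a subset $R\subseteq[0,\infty)$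 with $0\in R$. An ultrametric is a metric $d$ with $d(x,y)\le \max\{d(x,z),d(z,y)\}$ for all $x,y,z$. An ultrametric $d$ on a set $X$ is $R$-valued (an $R$-ultrametric) if $d(x,y)\in R$ for all $x,y\in X$. A subset $E\subseteq[0,\infty)$ is semi-sporadic if there is a strictly decreasing sequence $\{a_i\}_{i\in\mathbb{Z}_{\ge 0}}$ in $(0,\infty)$ with $\lim_{i\to\infty} a_i=0$ and $E=\{0\}\cup\{a_i\mid i\in\mathbb{Z}_{\ge0}\}$. A subset of $[0,\infty)$ is tenuous if it is finite or semi-sporadic. $\mathrm{TEN}(R)$ denotes the set of all tenuous subsets $S\subseteq R$ with $0\in S$. For a metric space $(X,d)$, $x\in X$ and $A\subseteq X$, put $d(x,A)=\inf_{a\in A}d(x,a)$; restrictions of a metric to subsets are denoted by the same symbol. For a range set $S$, $\mathscr{N}(S)$ is the class of all finite $S$-valued ultrametric spaces. For a class $\mathscr{C}$ of metric spaces, a metric space $(X,d)$ is $\mathscr{C}$-injective if for all $(A,a),(B,b)\in\mathscr{C}$ and all isometric embeddings $\phi:(A,a)\to(B,b)$, $\psi:(A,a)\to(X,d)$ there is an isometric embedding $\theta:(B,b)\to(X,d)$ with $\theta\circ\phi=\psi$. For a countable (possibly finite) range set $S$, the $S$-Urysohn universal ultrametric space is the non-empty separable complete $\mathscr{N}(S)$-injective $S$-valued ultrametric space, which is unique up to isometry. For an uncountable range set $R$, a metric space $(X,d)$ is $R$-petaloid if it is an $R$-valued ultrametric space and there is a family $\{\Pi(X,S)\}_{S\in\mathrm{TEN}(R)}$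 of subspaces of $X$ (called an $R$-petal of $X$) such that: (P1) for every $S\in\mathrm{TEN}(R)$, $(\Pi(X,S),d)$ is isometric to the $S$-Urysohn universal ultrametric space; (P2) $\bigcup_{S\in\mathrm{TEN}(R)}\Pi(X,S)=X$; (P3) $\Pi(X,S)\cap\Pi(X,T)=\Pi(X,S\cap T)$ for all $S,T\in\mathrm{TEN}(R)$; (P4) if $S,T\in\mathrm{TEN}(R)$ and $x\in\Pi(X,T)$, then $d(x,\Pi(X,S))\in(T\setminus S)\cup\{0\}$. *)

(* Defs.v *)
From HB Require Import structures.
From mathcomp Require Import all_boot all_order all_algebra.
From mathcomp Require Import all_classical all_reals all_analysis.

Set Implicit Arguments.
Unset Strict Implicit.
Unset Printing Implicit Defensive.

Import Order.TTheory GRing.Theory Num.Theory.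
Import numFieldTopology.Exports.

Local Open Scope classical_set_scope.
Local Open Scope ring_scope.

Section RangeSets.
Context {K : realType}.
Implicit Types R S E : set K.

Definition range_set R : Prop := R `<=` [set x | 0 <= x] /\ R 0.

Definition semi_sporadic E : Prop :=
  exists a : nat -> K,
    [/\ forall n, 0 < a n,
        decreasing_seq a,
        a n @[n --> \oo] --> (0 : K)
      & E = [set 0] `|` range a].

Definition tenuous E : Prop := finite_set E \/ semi_sporadic E.

Definition TEN R : set (set K) := [set S | [/\ tenuous S, S `<=` R & S 0]].

End RangeSets.

Section Metrics.
Context {K : realType}.

(* A distance is a bare function where being a metric is part of what has to be
   shown; spaces known to be metric are objects of [metricType K]. *)
Definition is_pseudometric (X : Type) (d : X -> X -> K) : Prop :=
  [/\ forall x y, 0 <= d x y,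
      forall x, d x x = 0,
      forall x y, d x y = d y x
    & forall x y z, d x y <= d x z + d z y].

Definition is_metric (X : Type) (d : X -> X -> K) : Prop :=
  is_pseudometric d /\ forall x y, d x y = 0 -> x = y.

Definition strong_triangle (X : Type) (d : X -> X -> K) : Prop :=
  forall x y z, d x y <= Num.max (d x z) (d z y).

Definition pseudo_ultrametric (X : Type) (d : X -> X -> K) : Prop :=
  is_pseudometric d /\ strong_triangle d.

Definition ultrametric (X : Type) (d : X -> X -> K) : Prop :=
  is_metric d /\ strong_triangle d.

Definition valued_in (R : set K) (X : Type) (d : X -> X -> K) : Prop :=
  forall x y, R (d x y).

Definition isometric_embedding (X Y : Type) (d : X -> X -> K) (e : Y -> Y -> K)
    (f : X -> Y) : Prop :=
  forall x y, e (f x) (f y) = d x y.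

Definition dist_to_set (X : Type) (d : X -> X -> K) (x : X)
    (A : X -> Prop) : K :=
  inf [set r | exists2 a, A a & d x a = r].

Definition ultrametric_space (R : set K) (X : metricType K) : Prop :=
  ultrametric (@mdist K X) /\ valued_in R (@mdist K X).

Definition class_injective (C : metricType K -> Prop) (X : metricType K) :
    Prop :=
  forall A B : metricType K, C A -> C B ->
  forall (phi : A -> B) (psi : A -> X),
    isometric_embedding (@mdist K A) (@mdist K B) phi ->
    isometric_embedding (@mdist K A) (@mdist K X) psi ->
  exists2 theta : B -> X,
    isometric_embedding (@mdist K B) (@mdist K X) theta & theta \o phi = psi.

Definition finite_ultrametric_space (S : set K) (A : metricType K) : Prop :=
  finite_set [set: A] /\ ultrametric_space S A.

Definition separable (T : topologicalType) : Prop :=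
  exists2 D : set T, countable D & dense D.

(* The content of the library's [completeType], as a predicate. *)
Definition complete_space (T : uniformType) : Prop :=
  forall F : set_system T, ProperFilter F -> cauchy F -> exists x : T, F --> x.

Definition urysohn_universal (S : set K) (X : metricType K) : Prop :=
  [/\ [set: X] !=set0, separable X, complete_space X,
      class_injective (finite_ultrametric_space S) X
    & ultrametric_space S X].

(* The values of [Pi] outside [TEN R] play no role. Subsets of [X] are bare
   predicates, and are compared pointwise, because the library's [set X] is
   confined to the universe of the carriers of [metricType K], which is too low
   for the type of isometry classes below. The universal space being unique up
   to isometry, the first clause asks for some universal space [U] and for an
   isometry of [U] onto the subspace [Pi S], seen as a map into [X]. *)
Definition petal (R : set K) (X : Type) (d : X -> X -> K)
    (Pi : set K -> X -> Prop) : Prop :=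
  [/\ forall S, TEN R S ->
        exists2 U : metricType K, urysohn_universal S U &
        exists2 f : U -> X, isometric_embedding (@mdist K U) d f &
          forall x, Pi S x <-> exists u, f u = x,
      forall x, exists2 S, TEN R S & Pi S x,
      forall S T, TEN R S -> TEN R T ->
        forall x, Pi S x /\ Pi T x <-> Pi (S `&` T) x
    & forall S T x, TEN R S -> TEN R T -> Pi T x ->
        ((T `\` S) `|` [set 0]) (dist_to_set d x (Pi S))].

Definition petaloid (R : set K) (X : Type) (d : X -> X -> K) : Prop :=
  [/\ ultrametric d, valued_in R d & exists Pi : set K -> X -> Prop, petal R d Pi].

End Metrics.

Section NearlyDiscrete.
Context {K : realType}.

Definition nearly_discrete_dist (R : set K) (x y : R) : K :=
  if x == y then 0 else Num.max (val x) (val y).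

Definition nearly_discrete (R : set K) of range_set R : Type := R.

Context (R : set K) (hR : range_set R).
Local Notation M := (@nearly_discrete_dist R).

Let val_ge0 (x : R) : 0 <= val x.
Proof. by apply: hR.1; exact: set_valP. Qed.

Let Mxx x : M x x = 0.
Proof. by rewrite /nearly_discrete_dist eqxx. Qed.

Let Mpos x y : M x y = 0 -> x = y.
Proof.
rewrite /nearly_discrete_dist; case: eqVneq => // _ m0; apply/val_inj.
have : Num.max (val x) (val y) <= 0 by rewrite m0.
rewrite ge_max => /andP[x0 y0].
by apply/eqP; rewrite eq_le (le_trans x0 (val_ge0 y)) (le_trans y0 (val_ge0 x)).
Qed.

Let Msym x y : M x y = M y x.
Proof. by rewrite /nearly_discrete_dist eq_sym maxC. Qed.

Let M_ge0 x y : 0 <= M x y.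
Proof.
by rewrite /nearly_discrete_dist; case: ifP => // _; rewrite le_max val_ge0.
Qed.

Let Mstrong y x z : M x z <= Num.max (M x y) (M y z).
Proof.
have [<-|xy] := eqVneq x y; first by rewrite le_max lexx orbT.
have [<-|yz] := eqVneq y z; first by rewrite le_max lexx.
have [<-|xz] := eqVneq x z; first by rewrite Mxx le_max M_ge0.
rewrite /nearly_discrete_dist (negPf xy) (negPf yz) (negPf xz).
by rewrite ge_max !le_max !lexx /= !orbT.
Qed.

Let Mtri y x z : M x z <= M x y + M y z.
Proof.
by rewrite (le_trans (Mstrong y x z))// ge_max lerDl lerDr !M_ge0.
Qed.

HB.instance Definition _ := Choice.on (nearly_discrete hR).
HB.instance Definition _ :=
  isMetric.Build K (nearly_discrete hR) Mxx Mpos Msym Mtri.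

End NearlyDiscrete.

Section ContinuousMaps.
Context {K : realType} (R : set K) (hR : range_set R).

Definition C0 : Type :=
  {f : cantor_space -> nearly_discrete hR |
    continuous f /\ exists x, val (f x : R) = 0}.

Definition C0_dist (f g : C0) : K :=
  inf [set e | 0 < e /\ forall x,
         val (sval f x : R) <= Num.max (val (sval g x : R)) e /\
         val (sval g x : R) <= Num.max (val (sval f x : R)) e].

End ContinuousMaps.

Section ContinuousPseudoUltrametrics.

Definition ultrametrizable (K : realType) (X : topologicalType) : Prop :=
  exists2 d : X -> X -> K, ultrametric d &
    forall x : X, nbhs x = nbhs_ball_ (fun y e => [set z | d y z < e]) x.

Context {K : realType}.

Definition Cpu (X : topologicalType) (R : set K) : Type :=
  {d : X -> X -> K | [/\ pseudo_ultrametric d, valued_in R d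
                       & continuous (fun p : X * X => d p.1 p.2)]}.

Definition UD (X : topologicalType) (R : set K) (d e : Cpu X R) : K :=
  inf [set eps | R eps /\ forall x y,
         sval d x y <= Num.max (sval e x y) eps /\
         sval e x y <= Num.max (sval d x y) eps].

End ContinuousPseudoUltrametrics.

Section GromovHausdorff.
Context {K : realType}.

Definition isometric (X Y : metricType K) : Prop :=
  exists2 f : X -> Y, isometric_embedding (@mdist K X) (@mdist K Y) f
                    & range f = [set: Y].

Definition hausdorff_dist (Z : metricType K) (A B : set Z) : K :=
  Num.max (sup [set dist_to_set (@mdist K Z) a B | a in A])
          (sup [set dist_to_set (@mdist K Z) b A | b in B]).

Record compact_ultrametric_space (R : set K) : Type := CompactUltrametric {
  cus_space :> metricType K;
  cus_nonempty : [set: cus_space] !=set0;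
  cus_compact : compact [set: cus_space];
  cus_ultrametric : ultrametric_space R cus_space
}.

Definition NA_space (R : set K) (X Y : metricType K) : K :=
  inf [set r | exists Z : metricType K, ultrametric_space R Z /\
        exists (i : X -> Z) (j : Y -> Z),
          [/\ isometric_embedding (@mdist K X) (@mdist K Z) i,
              isometric_embedding (@mdist K Y) (@mdist K Z) j
            & r = hausdorff_dist (range i) (range j)]].

Lemma NA_space_isometric (R : set K) (X X' Y Y' : metricType K) :
  isometric X X' -> isometric Y Y' -> NA_space R X Y = NA_space R X' Y'.
Proof.
have le_iso (A A' B B' : metricType K) : isometric A A' -> isometric B B' ->
    forall r, (exists Z : metricType K, ultrametric_space R Z /\
        exists (i : A' -> Z) (j : B' -> Z),
          [/\ isometric_embedding (@mdist K A') (@mdist K Z) i,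
              isometric_embedding (@mdist K B') (@mdist K Z) j
            & r = hausdorff_dist (range i) (range j)]) ->
      exists Z : metricType K, ultrametric_space R Z /\
        exists (i : A -> Z) (j : B -> Z),
          [/\ isometric_embedding (@mdist K A) (@mdist K Z) i,
              isometric_embedding (@mdist K B) (@mdist K Z) j
            & r = hausdorff_dist (range i) (range j)].
  move=> [f f_iso f_surj] [g g_iso g_surj] r [Z [ZR [i [j [i_iso j_iso ->]]]]].
  exists Z; split=> //; exists (i \o f), (j \o g); split.
  - by move=> x y; rewrite /= i_iso f_iso.
  - by move=> x y; rewrite /= j_iso g_iso.
  - rewrite -[range (i \o f)](image_comp f i) f_surj.
    by rewrite -[range (j \o g)](image_comp g j) g_surj.
have iso_sym (A B : metricType K) : isometric A B -> isometric B A.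
  move=> [f f_iso f_surj].
  have /choice[g fg] (b : B) : exists a, f a = b.
    by have [a _ <-] : range f b; [rewrite f_surj | exists a].
  exists g; first by move=> x y; rewrite -f_iso !fg.
  apply/seteqP; split=> // a _; exists (f a) => //.
  by apply: mdist_positivity; rewrite -f_iso fg mdistxx.
move=> XX' YY'; congr inf; apply/seteqP; split=> r /=.
  by apply: le_iso; apply: iso_sym.
exact: le_iso.
Qed.

Definition isometry_classes (R : set K) : Type :=
  {C : compact_ultrametric_space R -> Prop |
    exists X : compact_ultrametric_space R, C = (fun Y => isometric X Y)}.

(* [NA] does not depend on the choice of representatives, by
   [NA_space_isometric]. *)
Definition representative (R : set K) (C : isometry_classes R) :
    compact_ultrametric_space R :=
  sval (cid (svalP C)).

Definition NA (R : set K) (C D : isometry_classes R) : K :=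
  NA_space R (representative C) (representative D).

End GromovHausdorff.

Section TenuousSupport.
Context {K : realType}.

(* Total version of the maximum, with value 0 on sets without a maximum. *)
Definition maximum (E : set K) : K := xget 0 [set m | E m /\ ubound E m].

Definition G_omega0 (R : set K) : Type :=
  {f : R -> nat | (forall r : R, val r = 0 -> f r = 0%N) /\
     tenuous ([set 0] `|` [set val r | r in [set r : R | f r <> 0%N]])}.

Definition G_dist (R : set K) (f g : G_omega0 R) : K :=
  if pselect (f = g) then 0
  else maximum [set val r | r in [set r : R | sval f r <> sval g r]].

End TenuousSupport.

(* Main.v *)
Require Import Defs.
From HB Require Import structures.
From mathcomp Require Import all_boot all_order all_algebra.
From mathcomp Require Import all_classical all_reals all_analysis.
From mathcomp Require Import lra.

(** In each of the four spaces a point [x] has a set [V x] of values: the image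
    of a map, the values of a pseudo-ultrametric, the distances realized in a
    compact space, the support of a map. Compactness (or the assumption on
    supports) makes [V x] tenuous. A point can also be truncated at a level [r],
    by replacing all values up to [r] by 0, and in all four cases the distance
    of [x] and [y] is the least [r] for which the truncations of [x] and [y] at
    [r] coincide. The petal of [S] consists of the points with values in [S].

    The record [truncation_system] isolates the properties of values and
    truncation from which everything follows, in [petaloid_of_system]. The
    distance is an ultrametric because agreement above level [r] is an
    equivalence relation that weakens as [r] grows, and it takes its values
    among the values of the two points ([ts_dist_value]), because truncation
    only changes when a value is crossed. The distance from [x] to the petal of
    [S] is the greatest value of [x] outside [S], attained at the truncation of
    [x] at that value. The petal is separable because truncations of its points
    at positive levels have finitely many values and there are countably many
    points with values in a given finite set. It has the extension property of
    the Urysohn space because over every truncated point there are infinitely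
    many points that differ from it by the one value [r]: these are at mutual
    distance [r], so any finite set leaves one of them at distance [r] from all
    its members ([ts_sphere]). Since an isometric embedding of a finite space is
    extended point by point, this suffices.

    It remains to find the structure in the examples. For maps with tenuous
    support it is immediate ([G_system]). Continuous maps on the Cantor set and
    continuous pseudo-ultrametrics are both instances of functions on a compact
    space all of whose truncations are locally constant ([function_system]); the
    compact space has binary coordinates, a locally constant map depends on
    finitely many of them ([locconst_factor]), which gives tenuous images and
    countability, and the cells around an accumulation point shrink forever,
    which gives infinitely many ways to add a value. For isometry classes of
    compact spaces, truncation is the quotient by the relation of being at
    distance at most [r]. Spaces whose truncations at all positive levels are
    isometric are isometric by a compactness argument
    ([coarse_isometric_isometric]); limits are inverse limits of finite spaces
    ([inverse_limit]); points are added by blowing up each point to a cluster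
    ([cluster_copies]); and the Gromov--Hausdorff distance is the least level of
    agreement by gluing two spaces along a coarse isometry ([gluing_space]). *)

Set Implicit Arguments.
Unset Strict Implicit.
Unset Printing Implicit Defensive.

Import Order.TTheory GRing.Theory Num.Theory.
Import numFieldTopology.Exports.

Local Open Scope classical_set_scope.
Local Open Scope ring_scope.

(** * Truncation of numbers and thin sets *)
Section Truncation.
Context {K : realType}.
Implicit Types (r s u v w : K) (S T : set K).

Definition trunc r v : K := if r < v then v else 0.

Lemma trunc_gt r v : r < v -> trunc r v = v.
Proof. by rewrite /trunc => ->. Qed.

Lemma trunc_le r v : v <= r -> trunc r v = 0.
Proof. by rewrite /trunc ltNge => ->. Qed.

Lemma trunc_at0 r : 0 <= r -> trunc r 0 = 0.
Proof. exact: trunc_le. Qed.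

Lemma trunc_ge0 r v : 0 <= r -> 0 <= trunc r v.
Proof. by rewrite /trunc; case: ltP => // rv r0; rewrite ltW// (le_lt_trans r0). Qed.

Lemma trunc_trunc r s v : 0 <= r -> 0 <= s -> trunc r (trunc s v) = trunc (Num.max r s) v.
Proof.
move=> r0 s0; rewrite /trunc gt_max.
by case: (ltP s v) => _; rewrite ?andbT// andbF ltNge r0.
Qed.

Lemma trunc_mono r s u v : 0 <= r -> r <= s ->
  trunc r u = trunc r v -> trunc s u = trunc s v.
Proof.
move=> r0 rs; have s0 := le_trans r0 rs.
have sr w : trunc s w = trunc s (trunc r w) by rewrite trunc_trunc// max_l.
by rewrite (sr u) (sr v) => ->.
Qed.

Lemma trunc_eq_gt r u v : 0 <= r -> trunc r u = trunc r v -> r < u -> v = u.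
Proof.
move=> r0; rewrite /trunc => + ru; rewrite ru; case: ltP => // _ u0.
by rewrite u0 ltNge r0 in ru.
Qed.

Lemma trunc_eq0 r v : 0 <= r -> trunc r v = 0 -> v <= r.
Proof.
by rewrite /trunc; case: ltP => // rv r0 v0; rewrite v0 ltNge r0 in rv.
Qed.

(** The bridge between the two languages of the development: the inequalities
    that define the distances on function spaces say that two values become
    equal once everything up to [r] is collapsed to 0. *)
Lemma trunc_eqP r u v : 0 <= r -> 0 <= u -> 0 <= v ->
  (u <= Num.max v r /\ v <= Num.max u r) <-> trunc r u = trunc r v.
Proof.
move=> r0 u0 v0; split; last first.
  rewrite !le_max /trunc; case: (ltP r u) => ru; case: (ltP r v) => rv e.
  - by rewrite e lexx.
  - by rewrite e ltNge r0 in ru.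
  - by rewrite -e ltNge r0 in rv.
  - by rewrite !orbT.
rewrite !le_max /trunc; case: (ltP r u) => ru; case: (ltP r v) => rv //=;
  rewrite ?orbF => -[H1 H2].
- by apply/eqP; rewrite eq_le H1 H2.
- by have := le_trans H1 rv; rewrite leNgt ru.
- by have := le_trans H2 ru; rewrite leNgt rv.
Qed.

Lemma trunc_sep u v : 0 <= u -> 0 <= v ->
  (forall e, 0 < e -> trunc e u = trunc e v) -> u = v.
Proof.
wlog uv : u v / u < v => [hw u0 v0 e|].
  by case: (ltgtP u v) => // uv; [|symmetry]; apply: hw => // t /e.
move=> u0 v0 /(_ ((u + v) / 2)) H.
have : trunc ((u + v) / 2) u = trunc ((u + v) / 2) v by apply: H; lra.
by rewrite trunc_le ?trunc_gt//; lra.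
Qed.

Lemma trunc_max r u v : 0 <= r -> trunc r (Num.max u v) = Num.max (trunc r u) (trunc r v).
Proof.
move=> r0; have tl a b : a <= b -> Num.max (trunc r a) (trunc r b) = trunc r b.
  move=> ab; rewrite max_r// /trunc; case: ltP => ra; case: ltP => rb //.
    by have := lt_le_trans ra ab; rewrite ltNge rb.
  by rewrite (le_trans r0)// ltW.
by case: (leP u v) => uv; [rewrite tl | rewrite maxC tl// ltW].
Qed.

(** Any decreasing sequence of positive numbers tending to 0 would do. *)
Definition scale n : K := n.+1%:R^-1.

Lemma scale_gt0 n : 0 < scale n.
Proof. by rewrite /scale invr_gt0. Qed.

Lemma scale_ge0 n : 0 <= scale n.
Proof. exact/ltW/scale_gt0. Qed.

Lemma scale_le m n : (m <= n)%N -> scale n <= scale m.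
Proof. by move=> mn; rewrite /scale lef_pV2 ?posrE// ler_nat. Qed.

Lemma scale_lt e : 0 < e -> exists n, scale n < e.
Proof.
move=> e0; have := near_infty_natSinv_lt (PosNum e0).
by case=> n _ /(_ n (leqnn _)) ne; exists n.
Qed.

(** A sequence of ever finer truncations is constant from its first nonzero term
    on, so it consists of the truncations of that term (or of 0). This is what
    makes spaces of values, and later inverse limits, complete; moreover the
    limit takes no new value. *)
Lemma trunc_limit (T : nat -> K) : (forall n, 0 <= T n) ->
  (forall n, T n = trunc (scale n) (T n.+1)) ->
  exists2 v, 0 <= v /\ (v = 0 \/ exists n, v = T n) &
    forall n, trunc (scale n) v = T n.
Proof.
move=> T0 TS.
have Tstep n : 0 < T n -> T n.+1 = T n.
  by rewrite TS /trunc; case: ifP => //; rewrite ltxx.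
have Tup n k : 0 < T n -> T (n + k)%N = T n.
  move=> Tn; elim: k => [|k IH]; first by rewrite addn0.
  by rewrite addnS Tstep// IH.
have Tdown n k : T n = trunc (scale n) (T (n + k)%N).
  elim: k n => [|k IH] n.
    rewrite addn0 {2}TS trunc_trunc ?scale_ge0//.
    by rewrite max_l// -TS.
  rewrite addnS -addSn TS (IH n.+1) trunc_trunc ?scale_ge0//.
  by rewrite max_l// scale_le.
have [[n Tn]|/forallNP nT] := pselect (exists n, 0 < T n).
  exists (T n); first by split => //; right; exists n.
  move=> m; have [mn|nm] := leqP m n.
    by rewrite (Tdown m (n - m)%N) subnKC.
  rewrite -(subnKC (ltnW nm)) -(Tup n (m - n)%N)// {2}(Tdown (n + _)%N 0%N).
  by rewrite addn0.
exists 0; first by split => //; left.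
move=> n; rewrite trunc_at0 ?scale_ge0//.
by apply/eqP; rewrite eq_le T0 leNgt/=; apply/negP/nT.
Qed.

(** For a set of nonnegative numbers containing 0, being thin is the same as
    being tenuous, but it is stable under subsets and finite unions without any
    reference to an enumeration. *)
Definition thin S := forall e, 0 < e -> finite_set (S `&` [set v | e <= v]).

Lemma thinS S T : S `<=` T -> thin T -> thin S.
Proof.
by move=> ST tT e /tT; apply: sub_finite_set => v [/ST].
Qed.

Lemma thinU S T : thin S -> thin T -> thin (S `|` T).
Proof. by move=> tS tT e e0; rewrite setIUl finite_setU; split; [exact: tS|exact: tT]. Qed.

Lemma finite_thin S : finite_set S -> thin S.
Proof. by move=> fS e _; exact: finite_setIl. Qed.

Lemma finite_max S : finite_set S -> S !=set0 -> exists2 m, S m & ubound S m.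
Proof.
move=> /finite_seqP[s ->]; elim: s => [|a s IH]; first by case.
move=> _; have [->|s0] := eqVneq s [::].
  exists a; first by rewrite /= inE.
  by move=> x /=; rewrite !inE => /eqP ->.
have [|m ms um] := IH.
  by case: s s0 {IH} => // b s _; exists b; rewrite /= inE eqxx.
exists (Num.max a m).
  by rewrite /= inE; case: (leP a m) => _; rewrite ?eqxx// [_ \in s]ms orbT.
move=> x /=; rewrite inE le_max => /orP[/eqP ->|/um ->]; first by rewrite lexx.
by rewrite orbT.
Qed.

Lemma finite_min S : finite_set S -> S !=set0 -> exists2 m, S m & lbound S m.
Proof.
move=> fS [x Sx]; have [||m [y Sy ym] um] := @finite_max ((fun x => - x) @` S).
- exact: finite_image.
- by exists (- x), x.
exists y => // z Sz; rewrite -lerN2 ym; apply: um.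
by exists z.
Qed.

Lemma thin_max S : thin S -> forall v, S v -> 0 < v ->
  exists2 m, S m & v <= m /\ ubound S m.
Proof.
move=> tS v Sv v0.
have [||m [Sm vm] um] := @finite_max (S `&` [set w | v <= w]).
- exact: tS.
- by exists v; split => //=.
exists m => //; split => // w Sw; have [vw|wv] := leP v w; first exact: um.
by rewrite (le_trans (ltW wv)).
Qed.

Lemma finite_gap S : finite_set S -> (forall v, S v -> 0 <= v) ->
  exists2 s, 0 < s & forall v, S v -> v = 0 \/ s < v.
Proof.
move=> fS S_ge0; have [[v Sv]|nS] := pselect (S `&` [set v | 0 < v] !=set0); last first.
  exists 1 => // v Sv; have := S_ge0 v Sv; rewrite le_eqVlt => /predU1P[|v0].
    by left.
  by case: nS; exists v.
have [||m [Sm m0] mm] := @finite_min (S `&` [set v | 0 < v]).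
- exact: finite_setIl.
- by exists v.
exists (m / 2); first by rewrite /= in m0; lra.
move=> w Sw; have := S_ge0 w Sw; rewrite le_eqVlt => /predU1P[|w0]; first by left.
by right; have := mm w (conj Sw w0); rewrite /= in m0; lra.
Qed.

Lemma thin_ubound S : thin S -> exists m, ubound S m.
Proof.
move=> tS; have [[v Sv v0]|nS] := pselect (exists2 v, S v & 0 < v).
  by have [m _ [_ mmax]] := thin_max tS Sv v0; exists m.
exists 0 => v Sv; rewrite leNgt; apply/negP => v0; apply: nS; by exists v.
Qed.

(** Below any level a thin set has a greatest element: between that element and
    the level there is a gap, and distances never fall into a gap. *)
Lemma thin_floor S r : thin S -> S 0 -> 0 <= r ->
  exists2 s, S s & [/\ 0 <= s, s <= r & forall v, S v -> v <= r -> v <= s].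
Proof.
move=> tS S0 r0.
have [[v [[Sv v0] vr]]|/forallNP nv] := pselect (exists v, (S v /\ 0 < v) /\ v <= r).
  have tS' : thin (S `&` [set w | w <= r]) by apply: thinS tS => w [].
  have [m [Sm /= mr] [vm um]] := thin_max tS' (conj Sv vr) v0.
  by exists m => //; split => // [|w Sw wr]; [exact: le_trans (ltW v0) vm|exact: um].
exists 0 => //; split => // v Sv vr; rewrite leNgt; apply/negP => v0.
exact: (nv v).
Qed.

Lemma tenuous_thin S : tenuous S -> thin S.
Proof.
case=> [|[a [a0 da /cvgrPdist_lt acvg ->]]]; first exact: finite_thin.
move=> e e0; have := acvg e e0; case=> N _ aN.
apply: (@sub_finite_set _ _ (a @` `I_N)); last exact/finite_image/finite_II.
move=> v [[->|[n _ <-]]] /= ev; first by rewrite leNgt e0 in ev.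
exists n => //=; rewrite ltnNge; apply/negP => Nn.
have := aN n Nn; rewrite sub0r normrN ger0_norm ?(ltW (a0 n))//.
by rewrite ltNge ev.
Qed.

(** The positive elements of an infinite thin set are enumerated in decreasing
    order by iterating the predecessor map, since the elements below any
    positive one form again a thin set that has a greatest element. The
    enumeration tends to 0 because only finitely many elements exceed a positive
    number, and it is exhaustive because no element is skipped. *)
Lemma thin_tenuous S : (forall v, S v -> 0 <= v) -> S 0 -> thin S -> tenuous S.
Proof.
move=> S_ge0 S0 tS; have [fS|iS] := pselect (finite_set S); first by left.
right.
have small e : 0 < e -> exists v, [/\ S v, 0 < v & v < e].
  move=> e0; apply: contrapT => /forallNP nv; apply: iS.
  apply: (@sub_finite_set _ _ ([set 0] `|` (S `&` [set v | e <= v]))).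
    move=> v Sv; have := S_ge0 v Sv; rewrite le_eqVlt => /predU1P[<-|v0].
      by left.
    by right; split => //=; rewrite leNgt; apply/negP => ve; apply: (nv v).
  by rewrite finite_setU; split; [exact: finite_set1|exact: tS].
(* p e is the greatest element of S below a positive e *)
have prev e : exists m, 0 < e -> [/\ S m, 0 < m, m < e &
    forall w, S w -> w < e -> w <= m].
  have [e0|e0] := ltP 0 e; last by exists 0.
  have [v [Sv v0 ve]] := small e e0.
  have tS' : thin (S `&` [set w | w < e]) by apply: thinS tS => w [].
  have [m [Sm /= me] [vm um]] := thin_max tS' (conj Sv ve) v0.
  exists m => _; split => //; first exact: lt_le_trans vm.
  by move=> w Sw we; apply: um.
have {prev}/choice[p pP] := prev.
have [t [St t0 _]] := small 1 ltr01.
have [m0 Sm0 [tm0 um0]] := thin_max tS St t0.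
pose a n := iter n p m0.
have a_pos n : S (a n) /\ 0 < a n.
  elim: n => [|n [IH1 IH2]]; first by split => //; exact: lt_le_trans tm0.
  by rewrite /a /=; have [] := pP (a n) IH2.
have aS n : a n.+1 < a n by have [] := pP (a n) (a_pos n).2.
have da : decreasing_seq a by apply/decreasing_seqP.
have acvg e : 0 < e -> exists n, a n < e.
  move=> e0; apply: contrapT => /forallNP an.
  apply: infinite_nat; apply: (@sub_finite_set _ _ (a @^-1` (S `&` [set v | e <= v]))).
    move=> n _; split; first exact: (a_pos n).1.
    by rewrite /= leNgt; apply/negP/an.
  apply: finite_preimage (tS e e0) => m n _ _ amn.
  by apply/eqP; rewrite eqn_leq -!da amn !lexx.
exists a; split => //.
- by move=> n; exact: (a_pos n).2.
- apply/cvgrPdist_lt => e e0; have [N aN] := acvg e e0.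
  exists N => // n /= Nn; rewrite sub0r normrN ger0_norm ?(ltW (a_pos n).2)//.
  by rewrite (le_lt_trans _ aN)// da.
- apply/seteqP; split => [v Sv|v [->//|[n _ <-]]]; last exact: (a_pos n).1.
  have := S_ge0 v Sv; rewrite le_eqVlt => /predU1P[<-|v0]; first by left.
  right; have exn := acvg v v0.
  have := ex_minnP exn; case=> -[|n] anv nmin.
    by have := um0 v Sv; rewrite leNgt anv.
  exists n => //; apply/eqP; rewrite eq_le; apply/andP; split; last first.
    by rewrite leNgt; apply/negP => /nmin; rewrite ltnn.
  rewrite leNgt; apply/negP => van.
  have [_ _ _ /(_ v Sv van)] := pP (a n) (a_pos n).2.
  by rewrite leNgt [_ < _]anv.
Qed.

End Truncation.

(** * Truncation systems are petaloid *)
Section MetricCarrier.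
Context {K : realType} (T : Type) (d : T -> T -> K).

(** The metric is a phantom argument, so that one carrier can bear a metric
    structure chosen inside a proof. *)
Definition metric_carrier of is_metric d : Type := T.

Context (h : is_metric d).

Let dxx x : d x x = 0. Proof. by case: h => -[]. Qed.
Let dpos x y : d x y = 0 -> x = y. Proof. by case: h => _; apply. Qed.
Let dsym x y : d x y = d y x. Proof. by case: h => -[]. Qed.
Let dtri y x z : d x z <= d x y + d y z. Proof. by case: h => -[]. Qed.

HB.instance Definition _ := gen_eqMixin (metric_carrier h).
HB.instance Definition _ := gen_choiceMixin (metric_carrier h).
HB.instance Definition _ := isMetric.Build K (metric_carrier h) dxx dpos dsym dtri.

Definition metric_space : metricType K := metric_carrier h.

End MetricCarrier.

Section TruncationSystem.
Context {K : realType} (R : set K).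

(** [V x] is the set of values of [x], such as the image of a function or the
    distances realized in a space, and [E r x y] says that [x] and [y] agree as
    long as values up to [r] are not distinguished from 0. The distance will be
    the least [r] with [E r x y]; the axioms describe how this relation
    interacts with values. The point given by [ts_trunc] is [x] with its values
    up to [r] removed, [ts_gap] says that lowering the level changes nothing
    when no value is crossed, [ts_infinite] is the homogeneity behind the
    extension property, and [ts_countable] is behind separability. Cardinalities
    are phrased with maps to and from [nat], since [X] may be too large for sets
    of its points. *)
Record truncation_system (X : Type) (V : X -> set K) (E : K -> X -> X -> Prop) :
    Prop := TruncationSystem {
  ts_inhabited : exists x : X, True;
  ts_range : forall x, V x `<=` R;
  ts_zero : forall x, V x 0;
  ts_thin : forall x, thin (V x);
  ts_refl : forall r x, E r x x;
  ts_sym : forall r x y, E r x y -> E r y x;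
  ts_trans : forall r x y z, 0 <= r -> E r x y -> E r y z -> E r x z;
  ts_mono : forall r s x y, 0 <= r -> r <= s -> E r x y -> E s x y;
  ts_values : forall r x y v, 0 <= r -> E r x y -> V x v -> r < v -> V y v;
  ts_trunc : forall r x, 0 <= r ->
    exists2 y, E r x y & forall v, V y v -> v = 0 \/ r < v;
  ts_gap : forall s r x y, 0 <= s -> s <= r -> E r x y ->
    (forall v, V x v \/ V y v -> v <= r -> v <= s) -> E s x y;
  ts_small : forall r x y, 0 <= r ->
    (forall v, V x v \/ V y v -> v <= r) -> E r x y;
  ts_sep : forall x y, (forall e, 0 < e -> E e x y) -> x = y;
  ts_complete : forall x : nat -> X,
    (forall n, E (scale n) (x n) (x n.+1)) ->
    exists y, forall n, E (scale n) (x n) y;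
  ts_infinite : forall x r, R r -> 0 < r ->
    (forall v, V x v -> v = 0 \/ r < v) ->
    exists2 y : nat -> X, (forall i j, y i = y j -> i = j) &
      forall i, E r x (y i) /\ (forall v, V (y i) v -> V x v \/ v = r);
  ts_countable : forall S, finite_set S -> S `<=` R ->
    exists c : X -> nat,
      forall x y, V x `<=` S -> V y `<=` S -> c x = c y -> x = y
}.

Context (hR : range_set R) (X : Type) (V : X -> set K) (E : K -> X -> X -> Prop).
Hypothesis sys : truncation_system V E.

Let V_ge0 x v : V x v -> 0 <= v.
Proof. by move=> /(ts_range sys)/hR.1. Qed.

Let V2_thin x y : thin (V x `|` V y).
Proof. by apply: thinU; exact: (ts_thin sys). Qed.

(** Only the values of [x] and [y] above some positive level matter: if [x <> y]
    then agreement fails at some [e > 0], and by [ts_gap] any level of agreement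
    can be lowered to the value just below it. So the candidates are finitely
    many, and the least of them is a value, hence in [R]. *)
Lemma ts_least x y : exists r0, [/\ R r0, 0 <= r0 &
  forall r, 0 <= r -> (r0 <= r <-> E r x y)].
Proof.
have [<-|xy] := pselect (x = y).
  exists 0; split => //; first exact: hR.2.
  by move=> r r0; split => // _; exact: (ts_refl sys).
have [e [e0 nE]] : exists e, 0 < e /\ ~ E e x y.
  apply: contrapT => /forallNP H; apply: xy; apply: (ts_sep sys) => e e0.
  by apply: contrapT => nE; apply: (H e).
have W_ge0 v : (V x `|` V y) v -> 0 <= v by case; exact: V_ge0.
pose B := (V x `|` V y) `&` [set v | E v x y].
have fB : finite_set B.
  apply: sub_finite_set (@V2_thin x y _ e0) => v [Wv Ev]; split => //=.
  rewrite leNgt; apply/negP => ve; apply: nE.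
  exact: (ts_mono sys (W_ge0 _ Wv) (ltW ve)).
have floorB r : 0 <= r -> E r x y -> exists2 s, B s & s <= r.
  move=> r0 Er; have [|s Ws [s0 sr smax]] := thin_floor (@V2_thin x y) _ r0.
    by left; exact: (ts_zero sys).
  exists s => //; split => //=.
  by apply: (ts_gap sys s0 sr Er) => v Wv; exact: smax.
have [m Bm um] : exists2 m, B m & lbound B m.
  apply: finite_min => //.
  have [t Wt t0] : exists2 t, (V x `|` V y) t & 0 < t.
    apply: contrapT => H; apply: nE; apply: (ts_small sys (ltW e0)) => v Wv.
    by rewrite leNgt; apply/negP => ve; apply: H; exists v; rewrite ?(lt_trans e0).
  have [m Wm [_ mmax]] := thin_max (@V2_thin x y) Wt t0.
  exists m; split => //=; apply: (ts_small sys (W_ge0 _ Wm)).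
  by move=> v Wv; exact: mmax.
exists m; split.
- by case: Bm => -[] /(ts_range sys).
- by case: Bm => /W_ge0.
- move=> r r0; split=> [mr|Er].
    by case: Bm => /W_ge0 m0 Em; exact: (ts_mono sys m0 mr).
  by have [s Bs] := floorB r r0 Er; apply: le_trans; exact: um.
Qed.

Context (d : X -> X -> K).
Hypothesis dE : forall x y r, 0 <= r -> (d x y <= r <-> E r x y).
Hypothesis d_ge0 : forall x y, 0 <= d x y.

Let Ed x y : E (d x y) x y.
Proof. by apply/dE. Qed.

(** Otherwise the distance would lie in a gap of the values and could be lowered
    to the value below it. *)
Lemma ts_dist_value x y : V x (d x y) \/ V y (d x y).
Proof.
have [|s Ws [s0 sr smax]] := thin_floor (@V2_thin x y) _ (d_ge0 x y).
  by left; exact: (ts_zero sys).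
suff -> : d x y = s by [].
apply/eqP; rewrite eq_le sr andbT; apply/dE => //.
by apply: (ts_gap sys s0 sr (Ed x y)) => v Wv; exact: smax.
Qed.

Lemma ts_ultrametric : ultrametric d.
Proof.
have strong : strong_triangle d.
  move=> x y z; have m0 : 0 <= Num.max (d x z) (d z y) by rewrite le_max d_ge0.
  apply/dE => //; apply: (ts_trans sys m0 (y := z)); apply/dE => //;
  by rewrite le_max lexx ?orbT.
split => //; split; last first.
  move=> x y d0; apply: (ts_sep sys) => e e0; apply/dE; first exact: ltW.
  by rewrite d0 ltW.
split => //.
- by move=> x; apply/eqP; rewrite eq_le d_ge0 andbT; apply/dE => //; exact: (ts_refl sys).
- by move=> x y; apply/eqP; rewrite eq_le; apply/andP; split; apply/dE => //;
    apply: (ts_sym sys); exact: Ed.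
- move=> x y z; apply: (le_trans (strong x y z)).
  by rewrite ge_max lerDl lerDr !d_ge0.
Qed.

Let dum := ts_ultrametric.
Let dxx x : d x x = 0. Proof. by case: dum => -[[]]. Qed.
Let dsym x y : d x y = d y x. Proof. by case: dum => -[[]]. Qed.
Let dstrong x y z : d x y <= Num.max (d x z) (d z y). Proof. by case: dum. Qed.
Let dpos x y : d x y = 0 -> x = y. Proof. by case: dum => -[_ +] _; apply. Qed.

Lemma ts_valued : valued_in R d.
Proof. by move=> x y; case: (ts_dist_value x y) => /(ts_range sys). Qed.

Lemma ts_isosceles x y z : d x y < d y z -> d x z = d y z.
Proof.
move=> xyz; apply/eqP; rewrite eq_le; apply/andP; split.
  by apply: (le_trans (dstrong x z y)); rewrite ge_max lexx ltW.
have := dstrong y z x; rewrite le_max => /orP[|//].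
by rewrite (dsym y x) leNgt xyz.
Qed.

Definition petal_of S x := V x `<=` S.

Lemma avoid_finitely_many (B : Type) (l : seq B) (bad : B -> nat -> Prop) :
  (forall b i j, bad b i -> bad b j -> i = j) ->
  exists k, forall b, List.In b l -> ~ bad b k.
Proof.
move=> uniq_bad.
suff [k kP] : exists N, forall b, List.In b l -> forall k, (N <= k)%N -> ~ bad b k.
  by exists k => b bl; exact: kP bl k (leqnn k).
elim: l => [|b l [N IH]]; first by exists 0%N.
have [[i bi]|/forallNP nb] := pselect (exists i, bad b i).
  exists (maxn N i.+1) => c [<-|cl] k; rewrite geq_max => /andP[Nk ik].
    by move=> /(uniq_bad _ _ _ bi) ik'; rewrite ik' ltnn in ik.
  exact: IH Nk.
by exists N => c [<- k _|]; [exact: nb|exact: IH].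
Qed.

(** The core of injectivity. Cut [x] at level [r] and let [y k] be infinitely
    many points over the cut one that only gain the value [r]. Two different
    [y k] are at distance exactly [r], so a given point can be closer than [r]
    to at most one of them; some [y k] is therefore at distance [r] from all the
    prescribed points of the ball around [x]. *)
Lemma ts_sphere S (SR : S `<=` R) x r (B : Type) (l : seq B) (t : B -> X) :
  petal_of S x -> S r -> 0 < r ->
  exists u, [/\ petal_of S u, d u x <= r &
    forall b, List.In b l -> d x (t b) <= r -> d u (t b) = r].
Proof.
move=> Sx Sr r0; have r0' := ltW r0.
have [z Exz zv] := ts_trunc sys x r0'.
have [y yinj yP] := ts_infinite sys (SR _ Sr) r0 zv.
have Sz : petal_of S z.
  move=> v zv'; have [->|rv] := zv v zv'; first exact/Sx/(ts_zero sys).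
  by apply: Sx; exact: (ts_values sys r0' (ts_sym sys Exz) zv' rv).
have Sy k : petal_of S (y k) by move=> v /(yP k).2[/Sz|->].
have yx k : d (y k) x <= r.
  apply/dE => //; apply: (ts_sym sys); apply: (ts_trans sys r0' Exz).
  exact: (yP k).1.
have yy i j : i <> j -> d (y i) (y j) = r.
  move=> ij; have dr : d (y i) (y j) <= r.
    apply: (le_trans (dstrong _ _ x)); rewrite ge_max yx dsym yx //.
  have vd k : V (y k) (d (y i) (y j)) -> d (y i) (y j) = r.
    move=> /(yP k).2[/zv[/dpos/yinj//|]|//].
    by rewrite ltNge dr.
  by case: (ts_dist_value (y i) (y j)) => /vd.
have [|k kP] := @avoid_finitely_many B l (fun b k => d (y k) (t b) < r).
  move=> b i j bi bj; apply: contrapT => /yy ij.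
  have := dstrong (y i) (y j) (t b); rewrite ij le_max leNgt bi /=.
  by rewrite dsym leNgt bj.
exists (y k); split => // b bl xt; apply/eqP; rewrite eq_le; apply/andP; split.
  by apply: (le_trans (dstrong _ _ x)); rewrite ge_max yx xt.
by rewrite leNgt; apply/negP; exact: kP.
Qed.

(** A new point [z] is placed relative to a nearest old point [a]: points that
    are as close as [a] are handled by [ts_sphere], and for the points farther
    away the isosceles property leaves no choice. *)
Lemma ts_extend_point S (SR : S `<=` R) (B : metricType K) (l : seq B) (t : B -> X) z :
  ultrametric_space S B -> (forall b, petal_of S (t b)) ->
  {in l &, forall a b, d (t a) (t b) = mdist a b} ->
  exists2 u, petal_of S u & {in l, forall b, d u (t b) = mdist z b}.
Proof.
move=> [[_ Bstrong] BS] tS tl.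
have [zl|zl] := boolP (z \in l); first by exists (t z) => // b bl; exact: tl.
case: l tl zl => [|a0 l0] tl zl; first by exists (t z).
set l := a0 :: l0 in tl zl *.
have [a al amin] : exists2 a, a \in l & forall b, b \in l -> mdist z a <= mdist z b.
  have [||m [a al <-] am] := @finite_min K ((fun a => mdist z a) @` [set` l]).
  - exact/finite_image/finite_seq.
  - by exists (mdist z a0), a0 => //=; rewrite inE eqxx.
  by exists a => // b bl; apply: am; exists b.
have ra : 0 < mdist z a by rewrite mdist_gt0; apply: contraNneq zl => ->.
have [u [Su ua uP]] := @ts_sphere S SR (t a) (mdist z a) B l t (tS a) (BS z a) ra.
exists u => // b bl; have ab := tl _ _ al bl.
have bin : List.In b l by elim: (l) bl => // c s IH; rewrite inE => /predU1P[->|/IH]; [left|right].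
have [za|za] := leP (mdist z b) (mdist z a).
  have zab : mdist z b = mdist z a by apply/eqP; rewrite eq_le za amin.
  rewrite zab; apply: uP => //; rewrite ab.
  by apply: (le_trans (Bstrong _ _ z)); rewrite ge_max za metric_sym lexx.
have dab : mdist a b = mdist z b.
  apply/eqP; rewrite eq_le; apply/andP; split.
    by apply: (le_trans (Bstrong _ _ z)); rewrite ge_max metric_sym (ltW za) lexx.
  by have := Bstrong z b a; rewrite le_max leNgt za.
by rewrite -dab -ab; apply: ts_isosceles; rewrite ab dab (le_lt_trans ua).
Qed.

Lemma ts_injective S (SR : S `<=` R) (A B : metricType K)
    (phi : A -> B) (psi : A -> X) :
  finite_ultrametric_space S A -> finite_ultrametric_space S B ->
  (forall a, petal_of S (psi a)) -> (exists x, petal_of S x) ->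
  isometric_embedding (@mdist K A) (@mdist K B) phi ->
  isometric_embedding (@mdist K A) d psi ->
  exists t : B -> X, [/\ forall b, petal_of S (t b),
    isometric_embedding (@mdist K B) d t & forall a, t (phi a) = psi a].
Proof.
move=> [/finite_seqP[lA lAE] _] [/finite_seqP[lB lBE] Bu] Spsi [x0 Sx0] phi_iso psi_iso.
have lAP a : a \in lA by have : [set: A] a by []; rewrite lAE.
have lBP b : b \in lB by have : [set: B] b by []; rewrite lBE.
pose l0 := map phi lA.
(* t is isometric on a finite list, which grows until it exhausts B *)
suff ext l : exists t : B -> X, [/\ forall b, petal_of S (t b),
    {in l ++ l0 &, forall a b, d (t a) (t b) = mdist a b} &
    forall a, t (phi a) = psi a].
  have [t [St tl tphi]] := ext lB; exists t; split => // a b.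
  by apply: tl; rewrite mem_cat lBP.
elim: l => [|z l [t [St tl tphi]]].
  have /choice[t tP] b : exists x, petal_of S x /\ (forall a, phi a = b -> psi a = x).
    have [[a ab]|/forallNP nb] := pselect (exists a, phi a = b); last first.
      by exists x0; split => // a /nb.
    exists (psi a); split => // a' a'b; apply: dpos.
    by rewrite psi_iso -phi_iso ab a'b mdistxx.
  exists t; split => [b|b c|a]; first exact: (tP b).1; last by rewrite -((tP (phi a)).2 a).
  move=> /mapP[a _ ->] /mapP[a' _ ->].
  by rewrite -((tP (phi a)).2 a)// -((tP (phi a')).2 a')// psi_iso phi_iso.
have [zl|zl] := boolP (z \in l ++ l0).
  exists t; split => // a b; rewrite cat_cons !inE => /predU1P[->|al] /predU1P[->|bl];
  exact: tl.
have [u Su uP] := ts_extend_point SR z Bu St tl.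
exists (fun b => if b == z then u else t b); split.
- by move=> b; case: ifP.
- move=> a b; rewrite cat_cons !inE; case: eqVneq => [->|az] /=; case: eqVneq => [->|bz] //=.
  + by rewrite dxx mdistxx.
  + by move=> _ bl; exact: uP.
  + by move=> al _; rewrite dsym uP// metric_sym.
  + exact: tl.
- move=> a; case: eqVneq => // phiz; rewrite -phiz in zl; case/negP: zl.
  by rewrite mem_cat map_f ?orbT.
Qed.

(** Removing all values of a point leaves a point of every petal. *)
Lemma ts_petal_inhabited S : S 0 -> exists x, petal_of S x.
Proof.
move=> S0; have [x _] := ts_inhabited sys.
have [[r Vr rx]|nx] := pselect (exists2 r, V x r & 0 < r).
  have [m Vm [rm mmax]] := thin_max (@ts_thin _ _ _ sys x) Vr rx.
  have m0 : 0 <= m := V_ge0 Vm.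
  have [y Exy yv] := ts_trunc sys x m0; exists y => v Vv.
  have [->//|mv] := yv v Vv.
  by have := mmax v (ts_values sys m0 (ts_sym sys Exy) Vv mv); rewrite leNgt mv.
exists x => v Vv; have := V_ge0 Vv; rewrite le_eqVlt => /predU1P[<-//|v0].
by case: nx; exists v.
Qed.

(** A point of the petal is approximated within [scale n] by its truncation,
    whose values lie in the finite set [F n]; for each [n] there are countably
    many points with values in [F n]. *)
Lemma ts_dense S : thin S -> S `<=` R -> S 0 -> exists2 s : nat -> X,
  forall n, petal_of S (s n) &
  forall x, petal_of S x -> forall e, 0 < e -> exists n, d x (s n) < e.
Proof.
move=> tS SR S0; have [x0 Sx0] := ts_petal_inhabited S0.
pose F n := [set 0] `|` (S `&` [set v | scale n <= v]).
have FS n : F n `<=` S by move=> v [->|[]].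
have /choice[c cP] n : exists c : X -> nat, forall x y,
    V x `<=` F n -> V y `<=` F n -> c x = c y -> x = y.
  apply: (ts_countable sys) => [|v /FS/SR//].
  by rewrite finite_setU; split; [exact: finite_set1|exact: tS (scale_gt0 _)].
have /choice[s sP] (p : nat * nat) : exists x, petal_of S x /\
    (forall y, V y `<=` F p.1 -> c p.1 y = p.2 -> y = x).
  have [[y [Fy cy]]|/forallNP ny] := pselect (exists y, V y `<=` F p.1 /\ c p.1 y = p.2).
    exists y; split; first by move=> v /Fy/FS.
    by move=> z Fz cz; apply: cP Fz Fy _; rewrite cz cy.
  by exists x0; split => // y Fy cy; case: (ny y).
exists (fun n => if unpickle n is Some p then s p else x0).
  by move=> n; case: unpickle => [p|//]; exact: (sP p).1.
move=> x Sx e e0; have [n ne] := scale_lt e0.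
have [y Exy yv] := ts_trunc sys x (scale_ge0 n).
have Fy : V y `<=` F n.
  move=> v Vv; have [->|nv] := yv v Vv; first by left.
  right; split; last exact: ltW.
  by apply: Sx; exact: (ts_values sys (scale_ge0 n) (ts_sym sys Exy) Vv nv).
exists (pickle (n, c n y)); rewrite pickleK.
rewrite -((sP (n, c n y)).2 y Fy erefl).
by apply: le_lt_trans ne; apply/dE => //; exact: scale_ge0.
Qed.

Lemma ts_limit_petal S (x : nat -> X) y : S 0 -> (forall n, petal_of S (x n)) ->
  (forall n, E (scale n) (x n) y) -> petal_of S y.
Proof.
move=> S0 Sx xy v Vv; have := V_ge0 Vv; rewrite le_eqVlt => /predU1P[<-//|v0].
have [n nv] := scale_lt v0.
exact/(Sx n)/(ts_values sys (scale_ge0 n) (ts_sym sys (xy n)) Vv nv).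
Qed.

Section SmallCopy.
Context (S : set K) (TS : TEN R S) (s : nat -> X).
Hypothesis sS : forall n, petal_of S (s n).
Hypothesis sd : forall x, petal_of S x -> forall e, 0 < e -> exists n, d x (s n) < e.

Let SR : S `<=` R. Proof. by case: TS. Qed.
Let S0 : S 0. Proof. by case: TS. Qed.

(** A petal is replaced by the space of its distance functions to a dense
    sequence: these determine the points, and they live in the universe of the
    reals, however large the type [X] is. *)
Definition small_copy : Type :=
  {u : nat -> K | exists x, petal_of S x /\ u = fun n => d x (s n)}.

Definition from_copy (u : small_copy) : X := sval (cid (svalP u)).

Lemma from_copyP u : petal_of S (from_copy u) /\ sval u = fun n => d (from_copy u) (s n).
Proof. exact: svalP (cid (svalP u)). Qed.

Lemma from_copy_surj x : petal_of S x -> exists u, from_copy u = x.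
Proof.
move=> Sx; have ux : exists y, petal_of S y /\ (fun n => d x (s n)) = fun n => d y (s n).
  by exists x.
pose u : small_copy := exist (fun u => exists x, petal_of S x /\ u = fun n => d x (s n)) _ ux.
exists u.
have [_ /= uE] := from_copyP u.
apply: (ts_sep sys) => e e0; apply/dE; first exact: ltW.
have [n xn] := sd Sx e0; have un := congr1 (@^~ n) uE.
apply: (le_trans (dstrong _ _ (s n))); rewrite /= in un.
by rewrite ge_max -un (dsym (s n)) ltW.
Qed.

Lemma copy_metric : is_metric (fun u v => d (from_copy u) (from_copy v)).
Proof.
split; last first.
  move=> u v /dpos uv; apply: eq_sig_hprop; first by move=> *; exact: Prop_irrelevance.
  by rewrite -[proj1_sig u]/(sval u) -[proj1_sig v]/(sval v) (from_copyP u).2 (from_copyP v).2 uv.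
by case: dum => -[[p1 p2 p3 p4] _] _; split.
Qed.

Let U : metricType K := metric_space copy_metric.
Let f : U -> X := from_copy.
Let fE (u v : U) : mdist u v = d (f u) (f v). Proof. by []. Qed.

(** Nonemptiness, density and the extension property come from the lemmas above
    by transport along the isometry [f]. For completeness, a Cauchy filter
    yields points [a n] of sets of diameter below [scale n]; [ts_complete]
    provides the limit, which stays in the petal by [ts_limit_petal]. *)
Lemma copy_universal : urysohn_universal S U.
Proof.
have surj x : petal_of S x -> exists u : U, f u = x by exact: from_copy_surj.
split.
- have [x Sx] := ts_petal_inhabited S0; have [u _] := surj x Sx.
  by exists u.
- have /choice[g gP] n : exists u : U, f u = s n by exact: surj.
  exists (range g).
    by apply: (@sub_countable _ _ _ [set: nat]); [exact: card_image_le|exact: countableP].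
  move=> A [u Au] oA.
  have : nbhs u A by exact: open_nbhs_nbhs.
  rewrite -nbhs_ballE => -[e /= e0 eA].
  have [n un] := sd (from_copyP u).1 e0.
  exists (g n); split; last by exists n.
  by apply: eA; rewrite ballEmdist /= fE gP.
- move=> F PF /cauchy_ballP cF.
  have FF : Filter F by exact: filter_filter.
  have /choice[A AP] n : exists A : set U, F A /\ forall u v, A u -> A v -> mdist u v < scale n.
    have := cF _ (scale_gt0 n); case=> -[A B] [FA FB] AB.
    exists (A `&` B); split; first exact: filterI.
    move=> u v [Au _] [_ Bv]; have := AB (u, v) (conj Au Bv).
    by rewrite ballEmdist.
  have /choice[a aP] n : exists a, A n a by have [a] := filter_ex (AP n).1; exists a.
  have [|y yP] := ts_complete sys (x := fun n => f (a n)).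
    move=> n; apply/dE; first exact: scale_ge0.
    have [b [Ab Ab']] := filter_ex (filterI (AP n).1 (AP n.+1).1).
    apply: (le_trans (dstrong _ _ (f b))); rewrite ge_max -!fE.
    rewrite (ltW ((AP n).2 _ _ _ _))//= ltW//.
    by apply: lt_le_trans (scale_le (leqnSn n)); apply: (AP n.+1).2.
  have [u uy] := surj y (ts_limit_petal S0 (fun n => (from_copyP (a n)).1) yP).
  exists u => B; rewrite -nbhs_ballE => -[e /= e0 eB].
  have [n ne] := scale_lt e0.
  apply: filterS (AP n).1 => v Av; apply: eB; rewrite ballEmdist /= fE.
  apply: (le_lt_trans (dstrong _ _ (f (a n)))); rewrite gt_max -fE; apply/andP; split.
    rewrite fE uy dsym; apply: le_lt_trans ne.
    by apply/dE; [exact: scale_ge0|exact: yP].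
  by apply: lt_trans ne; exact: (AP n).2.
- move=> A B CA CB phi psi phi_iso psi_iso.
  have [t [St t_iso tphi]] := ts_injective SR CA CB (fun a => (from_copyP (psi a)).1)
    (ts_petal_inhabited S0) phi_iso (psi_iso : isometric_embedding _ d (f \o psi)).
  have /choice[g gP] b : exists u : U, f u = t b by exact: surj.
  exists g; first by move=> b c; rewrite fE !gP t_iso.
  apply/funext => a; apply: mdist_positivity.
  by rewrite fE /= gP tphi /f dxx.
- split; last by move=> u v; case: (ts_dist_value (f u) (f v)) => /((from_copyP _).1).
  by split; [exact: copy_metric|move=> u v w; exact: dstrong].
Qed.

End SmallCopy.

(** The petal of [S] consists of the points with values in [S], so the
    conditions on unions and intersections are about sets of values only. For
    the distance of [x] to a petal, let [m] be the greatest value of [x] outside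
    [S]. Truncating [x] at [m] gives a point of the petal within [m]; nothing is
    closer, since a point closer than [m] would share the value [m] with [x]. *)
Theorem petaloid_of_system : petaloid R d.
Proof.
split; [exact: ts_ultrametric|exact: ts_valued|].
exists petal_of; split.
- move=> S TS; have [tS SR S0] := TS.
  have [s sS sd] := ts_dense (tenuous_thin tS) SR S0.
  exists (metric_space (copy_metric S s)); first exact: copy_universal.
  exists (@from_copy S s) => // x; split; first exact: from_copy_surj.
  by move=> [u <-]; exact: (from_copyP u).1.
- move=> x; exists (V x) => //; split; [|exact: (ts_range sys)|exact: (ts_zero sys)].
  apply: thin_tenuous; [exact: V_ge0|exact: (ts_zero sys)|exact: (ts_thin sys)].
- by move=> S T _ _ x; rewrite /petal_of subsetI.
- move=> S T x [tS SR S0] _ Tx.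
  have [VS|] := pselect (V x `<=` S).
    right => /=; apply/eqP; rewrite eq_le; apply/andP; split.
      by apply: ge_inf; [exists 0 => _ [y _ <-]; exact: d_ge0|exists x].
    apply: lb_le_inf; first by exists (d x x), x.
    by move=> _ [y _ <-]; exact: d_ge0.
  move=> /existsNP[v /not_implyP[Vv nSv]].
  have v0 : 0 < v.
    by have := V_ge0 Vv; rewrite le_eqVlt => /predU1P[v0|//]; rewrite -v0 in nSv.
  have tV : thin (V x `\` S) by apply: thinS (@ts_thin _ _ _ sys x) => w [].
  have [m [Vm nSm] [vm mmax]] := thin_max tV (conj Vv nSv) v0.
  have m0 : 0 < m := lt_le_trans v0 vm.
  left; suff -> : dist_to_set d x (petal_of S) = m by split => //; exact: Tx.
  have [y Exy yv] := ts_trunc sys x (ltW m0).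
  have Sy : petal_of S y.
    move=> w Vw; have [->//|mw] := yv w Vw; apply: contrapT => nSw.
    have := mmax w (conj (ts_values sys (ltW m0) (ts_sym sys Exy) Vw mw) nSw).
    by rewrite leNgt mw.
  have low z : petal_of S z -> m <= d x z.
    move=> Sz; rewrite leNgt; apply/negP => zm; apply: nSm; apply: Sz.
    exact: (ts_values sys (d_ge0 x z) (Ed x z) Vm zm).
  apply/eqP; rewrite eq_le; apply/andP; split.
    apply: (@le_trans _ _ (d x y)); last by apply/dE => //; exact: ltW.
    by apply: ge_inf; [exists 0 => _ [z _ <-]; exact: d_ge0|exists y].
  apply: lb_le_inf; first by exists (d x y), y.
  by move=> _ [z Sz <-]; exact: low.
Qed.

End TruncationSystem.

(** * Maps with tenuous support *)
Section TenuousSupportSystem.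
Context {K : realType} (R : set K) (hR : range_set R).
Local Notation G := (G_omega0 R).

Let V (f : G) : set K := [set 0] `|` [set val t | t in [set t : R | sval f t <> 0%N]].
Let E (r : K) (f g : G) := forall t : R, r < val t -> sval f t = sval g t.

Let val_ge0 (t : R) : 0 <= val t.
Proof. by apply: hR.1; exact: set_valP. Qed.

Let G_intro (f : R -> nat) : (forall t, val t = 0 -> f t = 0%N) ->
  thin [set val t | t in [set t : R | f t <> 0%N]] -> exists x : G, sval x = f.
Proof.
move=> f0 tf.
have fP : (forall t, val t = 0 -> f t = 0%N) /\
    tenuous ([set 0] `|` [set val t | t in [set t : R | f t <> 0%N]]).
  split => //; apply: thin_tenuous.
  - by move=> v [->//|[t _ <-]].
  - by left.
  - by apply: thinU => //; apply: finite_thin; exact: finite_set1.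
by exists (exist _ f fP).
Qed.

Let G_eq (f g : G) : sval f =1 sval g -> f = g.
Proof.
move=> fg; apply: eq_sig_hprop; first by move=> *; exact: Prop_irrelevance.
exact/funext.
Qed.

Let G_zero (f : G) t : val t = 0 -> sval f t = 0%N.
Proof. exact: (svalP f).1. Qed.

Let V_val (f : G) t : sval f t <> 0%N -> V f (val t).
Proof. by move=> ft; right; exists t. Qed.

Let V_thin f : thin (V f).
Proof. exact/tenuous_thin/(svalP f).2. Qed.

Let G_sub (f g : G) : E 0 f g -> f = g.
Proof.
move=> fg; apply: G_eq => t; have := val_ge0 t; rewrite le_eqVlt => /predU1P[t0|/fg//].
by rewrite !G_zero.
Qed.

(** Values are the points of the support, and two maps agree above level [r]
    when they coincide on the part of [R] above [r]. The infinitely many maps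
    over a given one are obtained by changing its value at [r] alone. *)
Lemma G_system : truncation_system R V E.
Proof.
split.
- have [|f _] := @G_intro (fun=> 0%N) (fun _ _ => erefl); last by exists f.
  by apply: finite_thin; apply: (@sub_finite_set _ _ set0) => // v [].
- by move=> f v [->|[t _ <-]]; [exact: hR.2|exact: set_valP].
- by move=> f; left.
- exact: V_thin.
- by [].
- by move=> r f g fg t /fg.
- by move=> r f g h _ fg gh t rt; rewrite fg// gh.
- by move=> r s f g _ rs fg t st; apply: fg; exact: le_lt_trans st.
- move=> r f g v r0 fg [->|[t /= ft <-] rt]; first by rewrite ltNge r0.
  by apply: V_val; rewrite -fg.
- move=> r f r0; have [||g gE] := @G_intro (fun t => if r < val t then sval f t else 0%N).
  + by move=> t /G_zero ->; case: ifP.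
  + apply: thinS (V_thin f) => v [t /= ft <-]; apply: V_val.
    by move: ft; case: ifP.
  exists g; first by move=> t rt; rewrite gE rt.
  move=> v [->|[t /=]]; first by left.
  by rewrite gE; case: ifP => // rt _ <-; right.
- move=> s r f g s0 sr fg fgv t st; have [tr|/fg//] := leP (val t) r.
  have H (h : G) : (V h (val t) -> val t <= s) -> sval h t = 0%N.
    move=> ht; apply: contrapT => /V_val/ht; by rewrite leNgt st.
  by rewrite !H// => Vt; apply: fgv => //; [right|left].
- move=> r f g r0 fgv t rt.
  have H (h : G) : (V h (val t) -> val t <= r) -> sval h t = 0%N.
    move=> ht; apply: contrapT => /V_val/ht; by rewrite leNgt rt.
  by rewrite !H// => Vt; apply: fgv => //; [right|left].
- move=> f g fg; apply: G_sub => t t0.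
  by apply: (fg (val t / 2)); lra.
- move=> x xE.
  have xup n k : E (scale n) (x n) (x (n + k)%N).
    elim: k => [|k IH] t nt; first by rewrite addn0.
    rewrite IH// addnS xE//; apply: le_lt_trans nt.
    by apply: scale_le; rewrite leq_addr.
  (* N t is a stage from which on the value at t no longer changes *)
have /choice[N NP] (t : R) : exists n, 0 < val t -> scale n < val t.
    have [/scale_lt[n nt]|_] := ltP 0 (val t); first by exists n.
    by exists 0%N.
  pose f t := if 0 < val t then sval (x (N t)) t else 0%N.
  have fx n t : scale n < val t -> f t = sval (x n) t.
    move=> nt; have t0 : 0 < val t by apply: lt_trans nt; exact: scale_gt0.
    rewrite /f t0 (xup _ n)//; last exact: NP.
    by rewrite addnC -xup.
  have [||g gE] := @G_intro f.
  + by move=> t t0; rewrite /f t0 ltxx.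
  + move=> e e0; have [n ne] := scale_lt e0.
    apply: sub_finite_set (V_thin (x n) e0) => v [[t /= ft <-] et]; split => //.
    by apply: V_val; rewrite -fx//; exact: lt_le_trans et.
  by exists g => n t nt; rewrite gE (fx n).
- move=> f r Rr r0 fr; pose t0 : R := SigSub (mem_set Rr).
  have /choice[y yE] k : exists g : G, sval g = fun t => if val t == r then k else sval f t.
    apply: G_intro => [t t0'|].
      by rewrite t0' lt_eqF// G_zero.
    apply: (@thinS _ _ (V f `|` [set r])) => [v [t /= ft <-]|].
      by case: eqP ft => [-> _|_ /V_val]; [right|left].
    by apply: thinU => //; apply: finite_thin; exact: finite_set1.
  exists y.
    by move=> i j /(congr1 (fun g : G => sval g t0)); rewrite !yE /= eqxx.
  move=> k; split.
    by move=> t rt; rewrite yE gt_eqF.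
  move=> v [->|[t /=]]; first by left; left.
  by rewrite yE; case: eqP => [-> _ <-|_ /V_val + <-]; [right|left].
- move=> S /finite_seqP[l lE] SR.
  pose c (f : G) := [seq oapp (sval f) 0%N (insub v) | v <- l].
  exists (fun f => pickle (c f)) => f g fS gS /(pcan_inj pickleK)/eq_in_map cE.
  apply: G_eq => t.
  have [St|nSt] := pselect (S (val t)).
    have tl : val t \in l by have := St; rewrite lE.
    by have := cE _ tl; rewrite valK.
  have H (h : G) : V h `<=` S -> sval h t = 0%N.
    by move=> hS; apply: contrapT => /V_val/hS.
  by rewrite !H.
Qed.

(** The set on which two maps differ lies in the union of their supports, hence
    is thin; so the maximum in the definition of the distance is attained. *)
Lemma G_distE (f g : G) r : 0 <= r -> (G_dist f g <= r <-> E r f g).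
Proof.
move=> r0; rewrite /G_dist; case: pselect => /= fg; first by rewrite fg r0.
set A := [set val t | t in _].
have tA : thin A.
  apply: thinS (thinU (V_thin f) (V_thin g)) => v [t /= ft <-].
  have [f0|/V_val] := pselect (sval f t = 0%N); last by left.
  by right; apply: V_val => g0; apply: ft; rewrite f0 g0.
have [v Av v0] : exists2 v, A v & 0 < v.
  apply: contrapT => nA; apply: fg; apply: G_sub => t t0.
  by apply: contrapT => ft; apply: nA; exists (val t) => //; exists t.
have [m Am [_ mmax]] := thin_max tA Av v0.
have -> : maximum A = m.
  apply: xget_subset1 => // a b [Aa ua] [Ab ub].
  by apply/eqP; rewrite eq_le ub// ua.
split=> [mr t rt|fgr].
  apply: contrapT => ft; have := mmax (val t); rewrite leNgt (le_lt_trans mr)//.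
  by apply: contraPP => _ H; have := H (ex_intro2 _ _ t ft erefl).
by case: Am => t /= ft <-; rewrite leNgt; apply/negP => /fgr.
Qed.

Theorem G_petaloid : petaloid R (@G_dist K R).
Proof.
apply: (petaloid_of_system hR G_system G_distE) => f g.
rewrite /G_dist; case: pselect => //= fg; rewrite /maximum.
set P := [set m | _]; have [exP|/forallNP nP] := pselect (exists x, P x); last by rewrite xgetPN.
by have [[t _ <-] _] := xgetPex 0 exP; exact: val_ge0.
Qed.

End TenuousSupportSystem.

(** * Locally constant maps on compact ultrametrizable spaces *)
Section LocallyConstant.
Context {W : topologicalType}.

Definition locconst (T : Type) (h : W -> T) := forall x, nbhs x [set y | h y = h x].

Lemma locconst_comp (T U : Type) (g : T -> U) (h : W -> T) :
  locconst h -> locconst (g \o h).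
Proof. by move=> lh x; apply: filterS (lh x) => y /= ->. Qed.

Lemma locconst_pair (T U : Type) (g : W -> T) (h : W -> U) :
  locconst g -> locconst h -> locconst (fun x => (g x, h x)).
Proof. by move=> lg lh x; apply: filterS2 (lg x) (lh x) => y /= -> ->. Qed.

(** Binary coordinates embed the space in the Cantor set; for compact spaces,
    having them is the same as being ultrametrizable. *)
Definition coordinates (b : W -> nat -> bool) :=
  (forall n, locconst (b ^~ n)) /\ (forall x y, b x =1 b y -> x = y).

Context (cI : compact [set: W]) (b : W -> nat -> bool) (bP : coordinates b).

Definition cell n x : set W := [set y | forall k, (k < n)%N -> b y k = b x k].

Lemma cell_le m n x : (m <= n)%N -> cell n x `<=` cell m x.
Proof. by move=> mn y xy k km; apply: xy; exact: leq_trans mn. Qed.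

Lemma nbhs_cell n x : nbhs x (cell n x).
Proof.
elim: n => [|n IH]; first by apply: filterS filterT => y _ k; rewrite ltn0.
apply: filterS2 IH (bP.1 n x) => y xy yn k; rewrite ltnS leq_eqVlt => /predU1P[->//|].
exact: xy.
Qed.

Lemma locconst_cell n x : locconst (fun y => `[< cell n x y >]).
Proof.
move=> y; apply: filterS (nbhs_cell n y) => z yz /=; congr (asbool _).
by apply/propext; split => h k kn; [rewrite -yz// h|rewrite yz// h].
Qed.

(** If no finite number of coordinates sufficed, there would be pairs of points
    agreeing on more and more coordinates and separated by [h]. By compactness
    they accumulate at a pair of points with equal coordinates, that is at a
    point of the diagonal, near which [h] takes equal values on both
    components. *)
Lemma locconst_factor (T : Type) (h : W -> T) : locconst h ->
  exists n, forall x y, cell n x y -> h x = h y.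
Proof.
move=> lh; apply: contrapT => /forallNP nN.
have /choice[p pP] n : exists p : W * W, cell n p.1 p.2 /\ h p.1 <> h p.2.
  by have /existsNP[x /existsNP[y /not_implyP[xy hxy]]] := nN n; exists (x, y).
have cII : compact [set: W * W] by rewrite -setXTT; exact: compact_setX.
have [|[x y] [_ clxy]] := cII (p @ \oo) _; first exact: filterT.
have near_inf (A : set (W * W)) n : nbhs (x, y) A -> exists k, (n <= k)%N /\ A (p k).
  move=> nA; have [q [[k /= nk <-] Aq]] :=
    clxy [set p k | k in [set k | (n <= k)%N]] A
      (ex_intro2 _ _ n I (fun k nk => ex_intro2 _ _ k nk erefl)) nA.
  by exists k.
have xy : x = y.
  apply: bP.2 => n.
  have [|k [nk [/= kx ky]]] := near_inf ([set z | b z n = b x n] `*` [set z | b z n = b y n]) n.+1.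
    by exists ([set z | b z n = b x n], [set z | b z n = b y n]) => //=;
      split; exact: bP.1.
  by rewrite -kx -ky (pP k).1.
have [|k [_ [/= kx ky]]] := near_inf ([set z | h z = h x] `*` [set z | h z = h y]) 0%N.
  by exists ([set z | h z = h x], [set z | h z = h y]) => //=; split; exact: lh.
by apply: (pP k).2; rewrite kx ky xy.
Qed.

Definition word n x : n.-tuple bool := [tuple b x i | i < n].

Lemma word_cell n x y : word n x = word n y -> cell n x y.
Proof.
move=> xy k kn; have := congr1 (fun t => tnth t (Ordinal kn)) xy.
by rewrite !tnth_mktuple.
Qed.

Lemma locconst_finite (T : Type) (h : W -> T) : locconst h -> finite_set (range h).
Proof.
move=> /locconst_factor[n hn].
have [[x0 _]|nI] := pselect (exists x : W, True); last first.
  by apply: (@sub_finite_set _ _ set0) => // v [x]; case: nI; exists x.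
pose g w := h (xget x0 [set x | word n x = w]).
apply: (@sub_finite_set _ _ (g @` setT)); last exact/finite_image/finite_finset.
move=> _ [x _ <-]; exists (word n x) => //; apply/esym/hn/word_cell.
exact/esym/(xgetPex _ (P := [set y | word n y = word n x]) (ex_intro _ x erefl)).
Qed.

(** There are countably many locally constant maps to a countable set: such a
    map is given by a number [n] of coordinates and by a table of its values on
    the words of length [n]. *)
Lemma locconst_code (T : countType) (x0 : W) : exists c : (W -> T) -> nat,
  forall h g, locconst h -> locconst g -> c h = c g -> h = g.
Proof.
have /choice[N NP] (h : W -> T) : exists n, locconst h -> forall x y, cell n x y -> h x = h y.
  have [/locconst_factor[n hn]|nh] := pselect (locconst h); first by exists n.
  by exists 0%N.
(* rep n w is a point with the word w, and it depends on w only *)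
pose rep n w := xget x0 [set x | word n x = w].
have repP n x : cell n x (rep n (word n x)).
  apply/word_cell/esym/(xgetPex _ (P := [set y | word n y = word n x]) (ex_intro _ x erefl)).
pose c h := (N h, [seq h (rep (N h) w) | w <- enum {: (N h).-tuple bool}]).
exists (fun h => pickle (c h)) => h g lh lg /(pcan_inj pickleK)[hN].
rewrite hN => /eq_in_map hg; apply/funext => x.
rewrite (NP g lg _ _ (repP (N g) x)).
have /(NP h lh) -> : cell (N h) x (rep (N g) (word (N g) x)) by rewrite hN.
by apply: hg; rewrite mem_enum.
Qed.

(** The cells around an accumulation point shrink infinitely often. They are the
    source of the infinitely many points that [ts_infinite] asks for. *)
Lemma shrinking_cells n x : limit_point [set: W] x -> exists m : nat -> nat,
  (forall k, (n <= m k)%N) /\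
  forall j k, (j < k)%N -> exists2 y, cell (m j) x y & ~ cell (m k) x y.
Proof.
move=> lx.
have /choice[f fP] k : exists k', (k <= k')%N /\ exists2 y, cell k x y & ~ cell k' x y.
  have [y [yx _ xy]] := lx _ (nbhs_cell k x).
  have [l yl] : exists l, b y l <> b x l.
    by apply: contrapT => /forallNP H; move/eqP: yx; apply; apply: bP.2 => l; apply: contrapT => /H.
  exists (maxn k l.+1); split; first exact: leq_maxl.
  by exists y => // /(_ l); rewrite leq_maxr => /(_ isT).
pose m k := iter k f n.
have mle i j : (i <= j)%N -> (m i <= m j)%N.
  move=> /subnKC <-; elim: (j - i)%N => [|k IH]; first by rewrite addn0.
  by rewrite addnS; apply: (leq_trans IH); exact: (fP _).1.
exists m; split=> [k|j k jk]; first exact: (mle 0%N k).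
have [y xy nxy] := (fP (m j)).2; exists y => // /(cell_le (mle _ _ jk)).
exact: nxy.
Qed.

End LocallyConstant.

Lemma coordinates_prod (W J : topologicalType) (b : W -> nat -> bool) (c : J -> nat -> bool) :
  coordinates b -> coordinates c ->
  coordinates (fun (p : W * J) n => if odd n then b p.1 n./2 else c p.2 n./2).
Proof.
move=> [lb sb] [lc sc]; split=> [n [x y]|[x y] [x' y'] /= H].
  case: ifP => _.
    exists ([set z | b z n./2 = b x n./2], setT) => /=; last by move=> [z w] [].
    by split; [exact: lb|exact: filterT].
  exists (setT, [set z | c z n./2 = c y n./2]) => /=; last by move=> [z w] [].
  by split; [exact: filterT|exact: lc].
congr pair.
  by apply: sb => n; have := H n.*2.+1; rewrite /= odd_double /= uphalf_double.
by apply: sc => n; have := H n.*2; rewrite odd_double doubleK.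
Qed.

Lemma totally_bounded (K : realType) (T : topologicalType) (rho : T -> T -> K) e :
  compact [set: T] -> (forall x, nbhs x [set y | rho x y < e]) ->
  exists l : seq T, forall y, exists2 z, z \in l & rho z y < e.
Proof.
move=> cT rn; apply: contrapT => /forallNP nl.
(* the filter generated by the complements of finite unions of balls *)
pose F (A : set T) :=
  exists l : seq T, forall y, (forall z, z \in l -> ~ rho z y < e) -> A y.
have FF : ProperFilter F.
  split=> [[l lP]|].
    by apply: (nl l) => y; apply: contrapT => /forall2NP H; apply: (lP y) => z zl; case: (H z).
  split; first by exists [::].
    move=> A B [l lA] [k kB]; exists (l ++ k) => y ly.
    by split; [apply: lA => z zl|apply: kB => z zk]; apply: ly; rewrite mem_cat ?zl ?zk ?orbT.
  by move=> A B AB [l lA]; exists l => y /lA/AB.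
have [|x [_ clx]] := cT F FF; first by exists [::].
have [|y [xy yx]] := clx [set y | ~ rho x y < e] _ _ (rn x); last exact: xy.
by exists [:: x] => y; apply; rewrite inE.
Qed.

(** The coordinates record to which of the balls of a finite cover, for each
    scale, a point belongs; balls of an ultrametric are open and closed. *)
Lemma ultrametric_coordinates (K : realType) (X : topologicalType) :
  compact [set: X] -> ultrametrizable K X -> exists b : X -> nat -> bool, coordinates b.
Proof.
move=> cX [d [[[d0 dxx dsym _] dpos] dstrong] dn].
have nball e x : 0 < e -> nbhs x [set y | d x y < e].
  by move=> e0; rewrite dn; exists e.
have /choice[l lP] n : exists l : seq X, forall y, exists2 z, z \in l & d z y < scale n.
  by apply: totally_bounded => // x; exact/nball/scale_gt0.
pose b (x : X) (n : nat) := if unpickle n is Some (k, i) then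
  if (i < size (l k))%N then `[< d (nth x (l k) i) x < scale k >] else false else false.
exists b; split=> [n x|x y xy].
  apply: filterS (nball (scale (oapp (fst : nat * nat -> nat) 0%N (unpickle n))) x (scale_gt0 _)) => y /=.
  rewrite /b; case: unpickle => [[k i]|//]; case: ifP => // ik xy.
  rewrite (set_nth_default x)//; congr (asbool _); apply/propext; set z := nth _ _ _.
  split=> h.
    by apply: (le_lt_trans (dstrong _ _ y)); rewrite gt_max h dsym xy.
  by apply: (le_lt_trans (dstrong _ _ x)); rewrite gt_max h xy.
apply: dpos; apply/eqP; rewrite eq_le d0 andbT leNgt; apply/negP => /scale_lt[n nd].
have [z zl zx] := lP n x.
have := xy (pickle (n, index z (l n))); rewrite /b pickleK index_mem zl !nth_index//.
rewrite (asboolT zx) => /esym/asboolP zy.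
have := dstrong x y z; rewrite leNgt gt_max dsym => /negP; apply.
by rewrite (lt_trans zx nd) (lt_trans zy nd).
Qed.

(** * Systems of functions on a compact space *)
Lemma locconst_of_trunc (K : realType) (W : topologicalType) (phi : W -> K) r :
  0 <= r -> (forall i, phi i = 0 \/ r < phi i) -> locconst (trunc r \o phi) ->
  locconst phi.
Proof.
move=> r0 phir; congr locconst; apply/funext => i /=.
by have [->|ri] := phir i; [rewrite trunc_at0|rewrite trunc_gt].
Qed.

Section FunctionSystem.
Context {K : realType} (R : set K) (hR : range_set R).
Context (W : topologicalType) (cW : compact [set: W]) (x0 : W).
Context (b : W -> nat -> bool) (bP : coordinates b).
Context (Q : (W -> K) -> Prop).

(** On a nonnegative function, local constancy of all truncations means
    continuity both for the nearly discrete metric and, for pseudo-ultrametrics,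
    for the usual topology of the reals. [Q] collects the remaining closed
    conditions. *)
Definition tame (phi : W -> K) :=
  [/\ forall i, R (phi i), exists i, phi i = 0,
      forall r, 0 < r -> locconst (trunc r \o phi) & Q phi].

Hypothesis Q0 : Q (fun=> 0).
Hypothesis Q_trunc : forall r phi, 0 <= r -> Q phi -> Q (trunc r \o phi).
Hypothesis Q_limit : forall phi, (forall i, 0 <= phi i) ->
  (forall r, 0 < r -> Q (trunc r \o phi)) -> Q phi.
(* the clopen sets w k split the zero set of phi in infinitely many ways *)
Hypothesis Q_split : forall phi r, tame phi -> 0 < r ->
  (forall i, phi i = 0 \/ r < phi i) ->
  exists w : nat -> W -> bool,
  [/\ forall k, locconst (w k),
      forall k, exists i, phi i = 0 /\ w k i = false,
      forall k, Q (fun i => Num.max (phi i) (if w k i then r else 0)) &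
      forall j k, (j < k)%N -> exists i, phi i = 0 /\ w j i <> w k i].

Context (X : Type) (ev : X -> W -> K).
Hypothesis ev_inj : forall x y, ev x = ev y -> x = y.
Hypothesis ev_tame : forall x, tame (ev x).
Hypothesis ev_surj : forall phi, tame phi -> exists x, ev x = phi.

Let V x := range (ev x).
Let E r x y := forall i, trunc r (ev x i) = trunc r (ev y i).

Let ev_ge0 x i : 0 <= ev x i.
Proof. by apply: hR.1; case: (ev_tame x). Qed.

Let V_thin x : thin (V x).
Proof.
move=> e e0; have [_ _ /(_ (e / 2)) lx _] := ev_tame x.
apply: sub_finite_set (locconst_finite cW bP (lx _)); last by lra.
move=> _ [[i _ <-]] /= ei; exists i => //=; rewrite trunc_gt//; lra.
Qed.

Let tame_trunc r phi : 0 <= r -> tame phi -> tame (trunc r \o phi).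
Proof.
move=> r0 [Rphi [i phi0] lphi Qphi]; split.
- by move=> j; rewrite /= /trunc; case: ifP => // _; exact: hR.2.
- by exists i; rewrite /= phi0 trunc_at0.
- move=> s s0; have -> : trunc s \o (trunc r \o phi) = trunc (Num.max s r) \o phi.
    by apply/funext => j; rewrite /= trunc_trunc// ltW.
  by apply: lphi; rewrite lt_max s0.
- exact: Q_trunc.
Qed.

(** A limit of tame functions is tame; the delicate point is that it vanishes
    somewhere. If it did not, it would be locally constant, hence bounded below
    by a positive number, while its approximations do have zeros. *)
Let tame_limit (phi : W -> K) : (forall i, R (phi i)) ->
  (forall n, exists x, forall i, trunc (scale n) (phi i) = trunc (scale n) (ev x i)) ->
  tame phi.
Proof.
move=> Rphi /choice[x xP].
have phi_ge0 i : 0 <= phi i by apply: hR.1.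
have approx r : 0 < r -> exists x, trunc r \o phi = trunc r \o ev x.
  move=> /scale_lt[n nr]; exists (x n); apply/funext => i /=.
  exact: trunc_mono (scale_ge0 n) (ltW nr) (xP n i).
have lphi r : 0 < r -> locconst (trunc r \o phi).
  by move=> r0; have [y ->] := approx r r0; case: (ev_tame y) => _ _ + _; apply.
split => //.
  apply: contrapT => /forallNP phi0.
  have phi_gt0 i : 0 < phi i by rewrite lt_neqAle phi_ge0 andbT eq_sym; exact/eqP.
  have lphi' : locconst phi.
    move=> i; have i2 : 0 < phi i / 2 by have := phi_gt0 i; lra.
    apply: filterS (lphi _ i2 i) => j /= ji.
    by apply: (trunc_eq_gt (ltW i2) (esym ji)); have := phi_gt0 i; lra.
  have [|m [i _ <-] im] := finite_min (locconst_finite cW bP lphi').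
    by exists (phi x0), x0.
  have [n ni] := scale_lt (phi_gt0 i).
  have [_ [j xj] _ _] := ev_tame (x n).
  have := xP n j; rewrite xj trunc_at0 ?scale_ge0// => /(trunc_eq0 (scale_ge0 n)).
  by rewrite leNgt (lt_le_trans ni)//; apply: im; exists j.
apply: Q_limit => // r r0; have [y ->] := approx r r0.
by apply: Q_trunc; [exact: ltW|case: (ev_tame y)].
Qed.

(** Most axioms are pointwise facts on truncation, and the image of a tame
    function is thin because its truncations have finite range. For
    [ts_infinite], add the value [r] on the sets [w k] inside the zero set. For
    [ts_countable], a tame function with values in a finite set is locally
    constant. *)
Lemma function_system : truncation_system R V E.
Proof.
split.
- have [|x _] := @ev_surj (fun=> 0); last by exists x.
  split; [by move=> _; exact: hR.2|by exists x0| |exact: Q0].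
  by move=> r r0 i; apply: filterS filterT.
- by move=> x _ [i _ <-]; case: (ev_tame x).
- by move=> x; have [_ [i xi] _ _] := ev_tame x; exists i.
- exact: V_thin.
- by [].
- by move=> r x y xy i; rewrite xy.
- by move=> r x y z _ xy yz i; rewrite xy yz.
- by move=> r s x y r0 rs xy i; exact: trunc_mono (xy i).
- move=> r x y _ r0 xy [i _ <-] ri; exists i => //.
  exact: trunc_eq_gt (xy i) ri.
- move=> r x r0; have [y yE] := ev_surj (tame_trunc r0 (ev_tame x)).
  exists y => [i|_ [i _ <-]]; rewrite yE /=.
    by rewrite trunc_trunc// maxxx.
  by rewrite /trunc; case: ifP; [right|left].
- move=> s r x y s0 sr xy xyv i.
  have H z : (forall v, V z v -> v <= r -> v <= s) -> trunc s (ev z i) = trunc r (ev z i).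
    move=> zv; have [zr|zr] := leP (ev z i) r.
      by rewrite !trunc_le// zv//; exists i.
    by rewrite !trunc_gt// (le_lt_trans sr).
  by rewrite !H ?xy// => v Vv; apply: xyv; [right|left].
- by move=> r x y r0 xyv i; rewrite !trunc_le//; apply: xyv; [right|left]; exists i.
- move=> x y xy; apply: ev_inj; apply/funext => i.
  by apply: trunc_sep => // e /xy.
- move=> x xE.
  have TS i n : trunc (scale n) (ev (x n) i) =
      trunc (scale n) (trunc (scale n.+1) (ev (x n.+1) i)).
    by rewrite trunc_trunc ?scale_ge0// max_l ?scale_le// xE.
  have T0 i n : 0 <= trunc (scale n) (ev (x n) i) by apply: trunc_ge0; exact: scale_ge0.
  have /choice[phi phiP] i : exists v, R v /\
      forall n, trunc (scale n) v = trunc (scale n) (ev (x n) i).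
    have [v [_ vP] vn] := trunc_limit (T0 i) (TS i); exists v; split => //.
    case: vP => [->|[n ->]]; first exact: hR.2.
    by rewrite /trunc; case: ifP => _; [case: (ev_tame (x n))|exact: hR.2].
  have [|y yE] := @ev_surj phi.
    apply: tame_limit => [i|n]; first exact: (phiP i).1.
    by exists (x n) => i; exact: (phiP i).2.
  by exists y => n i; rewrite yE (phiP i).2.
- move=> x r Rr r0 xr.
  have {}xr i : ev x i = 0 \/ r < ev x i by apply: xr; exists i.
  have [w [lw w0 Qw wI]] := Q_split (ev_tame x) r0 xr.
  have [Rx _ tx _] := ev_tame x.
  have lx := locconst_of_trunc (ltW r0) xr (tx _ r0).
  have /choice[y yE] k : exists y, ev y = fun i => Num.max (ev x i) (if w k i then r else 0).
    apply: ev_surj; split => //.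
    - move=> i; case: (leP (ev x i)) => // _.
      by case: ifP => // _; exact: hR.2.
    - by have [i [xi wi]] := w0 k; exists i; rewrite xi wi maxxx.
    - move=> s s0.
      by apply: (@locconst_comp _ _ _ (fun p : K * bool => trunc s (Num.max p.1 (if p.2 then r else 0))) _
        (locconst_pair lx (lw k))).
  have yI j k : (j < k)%N -> y j <> y k.
    move=> /wI[i [xi wi]] yjk; have := congr1 (fun y => ev y i) yjk.
    rewrite !yE xi => H; apply: wi; move: H.
    case: (w j i); case: (w k i); rewrite ?maxxx// ?max_r ?ltW// => H; move: r0.
      by rewrite H ltxx.
    by rewrite -H ltxx.
  exists y.
    move=> j k yjk; case: (ltngtP j k) => // [/yI//|/yI H].
    by case: H.
  move=> k; split=> [i|_ [i _ <-]]; rewrite yE.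
    rewrite trunc_max ?ltW// [trunc r (if _ then _ else _)]trunc_le; last first.
      by case: ifP => // _; exact: ltW.
    by rewrite max_l// trunc_ge0// ltW.
  case: (leP (ev x i)) => _; last by left; exists i.
  case: ifP => _; first by right.
  by left; have [_ [j xj] _ _] := ev_tame x; exists j.
- move=> S /finite_seqP[l lE] SR.
  have [||s s0 sS] := @finite_gap K S.
  - by rewrite lE; exact: finite_seq.
  - by move=> v /SR/hR.1.
  have lx x : V x `<=` S -> locconst (ev x).
    move=> xS; have [_ _ tx _] := ev_tame x.
    apply: locconst_of_trunc (ltW s0) _ (tx _ s0) => i.
    by apply/sS/xS; exists i.
  have [c cP] := locconst_code cW bP nat x0.
  exists (fun x => c (fun i => index (ev x i) l)) => x y xS yS cxy.
  have := cP _ _ (@locconst_comp _ _ _ (index^~ l) _ (lx x xS))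
    (@locconst_comp _ _ _ (index^~ l) _ (lx y yS)) cxy.
  move=> xy; apply: ev_inj; apply/funext => i.
  have mem z : V z `<=` S -> ev z i \in l.
    by move=> zS; have : S (ev z i) by [apply: zS; exists i]; rewrite lE.
  have := congr1 (fun f => nth 0 l (f i)) xy.
  by rewrite /= !nth_index// mem.
Qed.

(** The infimum runs over [A], which may miss the least level [r0] (for instance
    when [r0 = 0] and [A] consists of positive numbers); it is enough that [A]
    approximates elements of [R] from above. *)
Lemma function_petaloid (A : set K) (D : X -> X -> K) :
  (forall e, A e -> 0 <= e) ->
  (forall r e, R r -> r < e -> exists2 s, A s & r <= s <= e) ->
  (forall x y, D x y = inf [set e | A e /\ forall i,
     ev x i <= Num.max (ev y i) e /\ ev y i <= Num.max (ev x i) e]) ->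
  petaloid R D.
Proof.
move=> A0 Adense DE.
have DP x y : R (D x y) /\ forall r, 0 <= r -> (D x y <= r <-> E r x y).
  have [r0 [Rr0 r00 r0P]] := ts_least hR function_system x y.
  suff -> : D x y = r0 by split.
  have low e : A e -> (forall i, ev x i <= Num.max (ev y i) e /\
      ev y i <= Num.max (ev x i) e) -> r0 <= e.
    move=> Ae xy; apply/r0P; first exact: A0.
    by move=> i; apply/trunc_eqP => //; exact: A0.
  have mem e : A e -> r0 <= e -> (forall i, ev x i <= Num.max (ev y i) e /\
      ev y i <= Num.max (ev x i) e).
    by move=> Ae /(r0P _ (A0 _ Ae)) xy i; apply/trunc_eqP => //; exact: A0.
  rewrite DE; apply/eqP; rewrite eq_le; apply/andP; split; last first.
    apply: lb_le_inf; last by move=> e [Ae xy]; exact: low.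
    have [|s As /andP[rs _]] := Adense r0 (r0 + 1) Rr0; first by rewrite ltrDl.
    by exists s; split => //; exact: mem.
  apply/ler_addgt0Pr => e e0.
  have [|s As /andP[rs se]] := Adense r0 (r0 + e) Rr0; first by rewrite ltrDl.
  apply: (le_trans _ se); apply: ge_inf; last by split => //; exact: mem.
  by exists 0 => z [/A0].
apply: (petaloid_of_system hR function_system) => x y; first exact: (DP x y).2.
exact/hR.1/(DP x y).1.
Qed.

End FunctionSystem.

(** * Continuous maps on the Cantor set *)
Section ContinuousMapsPetaloid.
Context {K : realType} (R : set K) (hR : range_set R).

Lemma cantor_coordinates : coordinates (fun (x : cantor_space) n => x n).
Proof.
split=> [n x|x y xy]; last exact/funext.
have := @proj_continuous nat (fun=> bool) n x [set x n].
by apply; rewrite nbhs_principalE; exact/principal_filterP.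
Qed.

Let ev (f : C0 hR) : cantor_space -> K := fun x => val (sval f x : R).
Let Q (phi : cantor_space -> K) := True.

Let val_ge0 (t : R) : 0 <= val t.
Proof. by apply: hR.1; exact: set_valP. Qed.

Let ballE (x : nearly_discrete hR) e : ball x e = [set y | nearly_discrete_dist (x : R) y < e].
Proof. exact: ballEmdist. Qed.

Let ev_tame f : tame R Q (ev f).
Proof.
have [cf f0] := svalP f; split => //; first by move=> x; exact: set_valP.
move=> r r0 x; have /= fx : nbhs x (sval f @^-1` ball (sval f x) r).
  exact: cf x _ (nbhsx_ballx _ _ r0).
apply: filterS fx => y; rewrite /= ballE /= /nearly_discrete_dist /ev.
case: eqVneq => [-> //|_]; rewrite gt_max => /andP[xr yr].
by rewrite !trunc_le// ltW.
Qed.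

(** Where [phi] is positive, it is locally constant; near a zero it is small. In
    both cases the nearly discrete distance to the given value is small. *)
Let ev_surj (phi : cantor_space -> K) : tame R Q phi -> exists f, ev f = phi.
Proof.
move=> [Rphi phi0 lphi _].
pose f (x : cantor_space) : nearly_discrete hR := SigSub (mem_set (Rphi x)) : R.
have fP : continuous f /\ exists x, val (f x : R) = 0.
  split=> // x A; rewrite -nbhs_ballE => -[e /= e0 eA].
  have [phix|phix] := eqVneq (phi x) 0.
    have e2 : 0 < e / 2 by lra.
    apply: filterS (lphi _ e2 x) => y /=; rewrite phix trunc_at0 ?ltW//.
    move=> /(trunc_eq0 (ltW e2)) ye; apply: eA; rewrite ballE /= /nearly_discrete_dist.
    by case: ifP => // _; rewrite gt_max /= phix e0 /=; lra.
  have v0 : 0 < phi x by rewrite lt_neqAle eq_sym phix; exact: hR.1.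
  have v2 : 0 < phi x / 2 by lra.
  apply: filterS (lphi _ v2 x) => y /= /esym /(trunc_eq_gt (ltW v2)) yx.
  have {}yx : phi y = phi x by apply: yx; lra.
  apply: eA; rewrite ballE /= /nearly_discrete_dist.
  by rewrite (_ : (f x : R) == f y)//; apply/eqP/val_inj.
by exists (exist _ f fP).
Qed.

(** New maps are obtained by raising a map from 0 to [r] outside a small cell
    around one of its zeros; the zero itself survives, and as the Cantor set has
    no isolated point there are infinitely many such cells. *)
Theorem C0_petaloid : petaloid R (@C0_dist K R hR).
Proof.
have Rge0 r : R r -> 0 <= r by exact: hR.1.
apply: (@function_petaloid K R hR _ cantor_space_compact point _ cantor_coordinates
  Q _ _ _ _ (C0 hR) ev _ ev_tame ev_surj [set e | 0 < e]) => //.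
- move=> phi r [Rphi [x phix] lphi _] r0 phir.
  have lphi0 := locconst_of_trunc (ltW r0) phir (lphi _ r0).
  have [n nphi] := locconst_factor cantor_space_compact cantor_coordinates lphi0.
  have [m [mn mI]] : exists m : nat -> nat, (forall k, (n <= m k)%N) /\
      forall j k, (j < k)%N -> exists2 y, cell (fun (x : cantor_space) n => x n) (m j) x y &
      ~ cell (fun (x : cantor_space) n => x n) (m k) x y.
    apply: shrinking_cells cantor_coordinates _ _ _.
    by have [_ ->] := cantor_perfect.
  exists (fun k y => ~~ `[< cell (fun (x : cantor_space) n => x n) (m k) x y >]); split => //.
  + by move=> k; apply: locconst_comp; exact: locconst_cell cantor_coordinates _ _.
  + by move=> k; exists x; split => //; apply/negbTE; rewrite negbK; apply/asboolP.
  + move=> j k /mI[y xy nxy]; exists y; split.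
      by rewrite -phix; apply/esym/nphi; exact: cell_le xy.
    by rewrite (asboolT xy) (asboolF nxy).
- move=> f g fg; apply: eq_sig_hprop; first by move=> *; exact: Prop_irrelevance.
  by apply/funext => x; apply: val_inj; exact: (congr1 (@^~ x) fg).
- by move=> e /ltW.
- by move=> r e /Rge0 r0 re; exists e => /=; [exact: le_lt_trans re|rewrite ltW//=].
Qed.

End ContinuousMapsPetaloid.

(** * Continuous pseudo-ultrametrics *)
Section ContinuousPseudoUltrametricsPetaloid.
Context {K : realType} (R : set K) (hR : range_set R).

(** Above level [r], an ultrametric does not notice moving points by at most
    [r]. *)
Lemma pseudo_ultrametric_trunc (X : Type) (d : X -> X -> K) r x y x' y' :
  0 <= r -> pseudo_ultrametric d -> d x x' <= r -> d y y' <= r ->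
  trunc r (d x y) = trunc r (d x' y').
Proof.
move=> r0 [[d0 _ dsym _] ds] xr yr; apply/trunc_eqP => //; split.
  apply: (le_trans (ds _ _ x')); rewrite ge_max !le_max xr orbT /=.
  by have := ds x' y y'; rewrite !le_max (dsym y') => /orP[->//|h]; rewrite (le_trans h yr) orbT.
apply: (le_trans (ds _ _ x)); rewrite ge_max !le_max (dsym x') xr orbT /=.
by have := ds x y' y; rewrite !le_max => /orP[->//|h]; rewrite (le_trans h yr) orbT.
Qed.

Context (X : topologicalType) (cX : compact [set: X]).
Context (b : X -> nat -> bool) (bP : coordinates b) (x0 : X).
Context (lx0 : limit_point [set: X] x0).

Let Q (phi : X * X -> K) := pseudo_ultrametric (fun x y => phi (x, y)).
Let ev (d : Cpu X R) : X * X -> K := fun p => sval d p.1 p.2.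

Let QP (phi : X * X -> K) : (forall p, 0 <= phi p) ->
  (forall x, phi (x, x) = 0) -> (forall x y, phi (x, y) = phi (y, x)) ->
  strong_triangle (fun x y => phi (x, y)) -> Q phi.
Proof.
move=> phi0 phixx phisym phis; split => //; split => // x y z.
by apply: (le_trans (phis x y z)); rewrite ge_max lerDl lerDr !phi0.
Qed.

Let ev_tame d : tame R Q (ev d).
Proof.
have [dP Rd cd] := svalP d; have [[d0 dxx dsym _] ds] := dP.
split=> [p||r r0 [x y]|]; [exact: Rd|by exists (x0, x0); exact: dxx| |exact: dP].
have near z : nbhs z [set z' | sval d z z' <= r].
  have := cd (z, z) [set v | v < r]; rewrite /= dxx => /(_ _)[].
    by apply: open_nbhs_nbhs; split => //; exact: open_lt.
  move=> [A B] /= [zA zB] AB; apply: filterS zB => z' Bz'.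
  by apply/ltW/(AB (z, z')); split => //=; exact: nbhs_singleton.
exists ([set z' | sval d x z' <= r], [set z' | sval d y z' <= r]) => /=.
  by split; exact: near.
move=> [x' y'] [/= xr yr]; apply/esym/pseudo_ultrametric_trunc => //.
exact: ltW.
Qed.

Let ev_surj (phi : X * X -> K) : tame R Q phi -> exists d, ev d = phi.
Proof.
move=> [Rphi phi0 lphi Qphi].
have dP : [/\ pseudo_ultrametric (fun x y => phi (x, y)),
    valued_in R (fun x y => phi (x, y)) &
    continuous (fun p : X * X => phi (p.1, p.2))].
  split => //.
  have -> : (fun p : X * X => phi (p.1, p.2)) = phi by apply/funext => -[].
  move=> p; apply/cvgrPdist_lt => e e0.
  have p0 : 0 <= phi p by exact: hR.1.
  have [phip|phip] := eqVneq (phi p) 0.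
    have e2 : 0 < e / 2 by lra.
    apply: filterS (lphi _ e2 p) => q /=; rewrite phip trunc_at0 ?ltW//.
    move=> /(trunc_eq0 (ltW e2)) qe; rewrite sub0r normrN ger0_norm; last exact: hR.1.
    lra.
  have v2 : 0 < phi p / 2 by rewrite divr_gt0// lt_neqAle eq_sym phip.
  apply: filterS (lphi _ v2 p) => q /= /esym /(trunc_eq_gt (ltW v2)) ->.
    by rewrite subrr normr0.
  lra.
exists (exist (fun d : X -> X -> K => [/\ pseudo_ultrametric d, valued_in R d &
  continuous (fun p : X * X => d p.1 p.2)]) _ dP).
by apply/funext => -[x y].
Qed.

(** New pseudo-ultrametrics are obtained by declaring points in and out of a
    cell around the accumulation point [x0] to be at distance at least [r].
    Different small cells give different results, seen at pairs formed by [x0]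
    and a point that lies in just one of them. *)
Theorem Cpu_petaloid : petaloid R (@UD K X R).
Proof.
have cXX : compact [set: X * X] by rewrite -setXTT; exact: compact_setX.
pose bb := coordinates_prod bP bP.
have Rge0 r : R r -> 0 <= r by exact: hR.1.
apply: (@function_petaloid K R hR _ cXX (x0, x0) _ bb
  Q _ _ _ _ (Cpu X R) ev _ ev_tame ev_surj R) => //.
- by apply: QP => // x y z; rewrite maxxx.
- move=> r phi r0 [[phi0 phixx phisym _] phis]; apply: QP => /=.
  + by move=> p; exact: trunc_ge0.
  + by move=> x; rewrite phixx trunc_at0.
  + by move=> x y; rewrite phisym.
  + move=> x y z /=; rewrite -trunc_max//.
    rewrite /trunc; case: ltP => h; last by case: ifP => // /ltW; exact: le_trans.
    by rewrite (lt_le_trans h (phis x y z)); exact: phis.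
- move=> phi phi0 Qphi; apply: QP => //.
  + move=> x; apply: trunc_sep => // e e0; have [[_ h _ _] _] := Qphi e e0.
    by rewrite [LHS]h trunc_at0// ltW.
  + by move=> x y; apply: trunc_sep => // e e0; have [[_ _ h _] _] := Qphi e e0; exact: h.
  + move=> x y z; rewrite leNgt; apply/negP => h.
    have h0 : 0 < phi (x, y) by apply: le_lt_trans h; rewrite le_max phi0.
    pose e := Num.max (Num.max (phi (x, z)) (phi (z, y))) (phi (x, y) / 2).
    have e0 : 0 < e by rewrite lt_max; apply/orP; right; lra.
    have exy : e < phi (x, y) by rewrite gt_max h /=; lra.
    have [_ /(_ x y z)] := Qphi e e0; rewrite /= trunc_gt//.
    rewrite (@trunc_le _ _ (phi (x, z))) ?(@trunc_le _ _ (phi (z, y))).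
    - by rewrite maxxx leNgt h0.
    - by rewrite !le_max lexx orbT.
    - by rewrite !le_max lexx.
- move=> phi r [Rphi _ lphi Qphi] r0 phir.
  have [[phi0 phixx phisym _] phis] := Qphi.
  have lphi0 := locconst_of_trunc (ltW r0) phir (lphi _ r0).
  have lx : locconst (fun y => phi (x0, y)).
    move=> y; have [[A B] [/= xA yB] AB] := lphi0 (x0, y).
    apply: filterS yB => z Bz; apply: (AB (x0, z)); split => //=.
    exact: nbhs_singleton.
  have [n nphi] := locconst_factor cX bP lx.
  have [m [mn mI]] := shrinking_cells bP n lx0.
  pose c k x := `[< cell b (m k) x0 x >].
  exists (fun k p => c k p.1 != c k p.2); split.
  + move=> k; apply: (@locconst_comp _ _ _ (fun q : bool * bool => q.1 != q.2)
      (fun p => (c k p.1, c k p.2))).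
    have lc := locconst_cell bP (m k) x0.
    move=> [x y]; exists ([set z | c k z = c k x], [set z | c k z = c k y]) => /=.
      by split; exact: lc.
    by move=> [x' y'] [/= -> ->].
  + by move=> k; exists (x0, x0); rewrite phixx eqxx.
  + move=> k; apply: QP => /=.
    * by move=> [x y]; rewrite le_max (phi0 x y).
    * by move=> x; rewrite phixx eqxx maxxx.
    * by move=> x y; rewrite phisym eq_sym.
    * move=> x y z /=; rewrite ge_max; apply/andP; split.
        apply: (le_trans (phis x y z)); rewrite ge_max !le_max !lexx /= orbT//.
      case: ifP => // cxy; last by rewrite !le_max phi0.
      rewrite !le_max; case: eqVneq => [cxz|_]; last by rewrite lexx !orbT.
      by rewrite -cxz cxy lexx !orbT.
  + move=> j k /mI[y xy nxy]; exists (x0, y); split.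
      by rewrite -(phixx x0); apply/esym/nphi; exact: cell_le xy.
    have cx l : cell b (m l) x0 x0 by [].
    by rewrite /c /= (asboolT xy) (asboolF nxy) (asboolT (cx j)) (asboolT (cx k)).
- move=> d e de; apply: eq_sig_hprop; first by move=> *; exact: Prop_irrelevance.
  by apply/funext => x; apply/funext => y; exact: (congr1 (@^~ (x, y)) de).
- by move=> r e Rr re; exists r => //; rewrite lexx ltW.
- move=> d e; congr inf; apply/seteqP; split => r [Rr h]; split => //.
    by move=> p; exact: h.
  by move=> x y; exact: (h (x, y)).
Qed.

End ContinuousPseudoUltrametricsPetaloid.

(** * Coarse isometries of compact ultrametric spaces *)
Lemma ultra_limit (I : Type) (F : set_system I) (Y : topologicalType)
    (f : I -> Y) :
  UltraFilter F -> compact [set: Y] ->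
  exists y : Y, forall A, nbhs y A -> F (f @^-1` A).
Proof.
move=> UF cY; have [|y [_ cly]] := cY (f @ F) _; first exact: filterT.
exists y => A yA; have [//|FA] := in_ultra_setVsetC (f @^-1` A) UF.
have fA : (f @ F) (f @` (f @^-1` ~` A)).
  apply: (@filterS _ F _ (~` (f @^-1` A))) => // i Ai; by exists i.
by have [_ [[i fi <-] Afi]] := cly _ _ fA yA.
Qed.

Section CoarseIsometry.
Context {K : realType}.
Implicit Types (X Y Z : metricType K) (r s e : K).

(** An isometry between the quotients of [X] and [Y] by the relation of being at
    distance at most [r]. Presenting it as a relation avoids choosing
    representatives, and makes symmetry and transitivity immediate. *)
Definition coarse_isometric r X Y := exists rho : X -> Y -> Prop,
  [/\ forall x, exists y, rho x y, forall y, exists x, rho x y &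
      forall x y x' y', rho x y -> rho x' y' ->
        trunc r (mdist x x') = trunc r (mdist y y')].

Lemma coarse_isometric_refl r X : coarse_isometric r X X.
Proof.
by exists (fun x y => x = y); split=> [x|x|x _ y _ <- <- //]; exists x.
Qed.

Lemma coarse_isometric_sym r X Y : coarse_isometric r X Y -> coarse_isometric r Y X.
Proof.
move=> [rho [rl rr rd]]; exists (fun y x => rho x y); split => //.
by move=> y x y' x' h h'; rewrite (rd x y x' y').
Qed.

Lemma coarse_isometric_trans r X Y Z :
  coarse_isometric r X Y -> coarse_isometric r Y Z -> coarse_isometric r X Z.
Proof.
move=> [rho [rl rr rd]] [sig [sl sr sd]].
exists (fun x z => exists2 y, rho x y & sig y z); split.
- by move=> x; have [y xy] := rl x; have [z yz] := sl y; exists z, y.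
- by move=> z; have [y yz] := sr z; have [x xy] := rr y; exists x, y.
- by move=> x z x' z' [y xy yz] [y' xy' yz']; rewrite (rd x y x' y')// (sd y z y' z').
Qed.

Lemma coarse_isometric_le r s X Y : 0 <= r -> r <= s ->
  coarse_isometric r X Y -> coarse_isometric s X Y.
Proof.
move=> r0 rs [rho [rl rr rd]]; exists rho; split => // x y x' y' h h'.
exact: trunc_mono (rd _ _ _ _ h h').
Qed.

Lemma isometric_coarse r X Y : isometric X Y -> coarse_isometric r X Y.
Proof.
move=> [f f_iso f_surj]; exists (fun x y => f x = y); split.
- by move=> x; exists (f x).
- by move=> y; have [x _ <-] : range f y; [rewrite f_surj|exists x].
- by move=> x _ x' _ <- <-; rewrite f_iso.
Qed.

Definition distance_set X : set K := [set v | exists x y : X, v = mdist x y].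

Lemma coarse_distance_set r X Y v : 0 <= r -> coarse_isometric r X Y ->
  distance_set X v -> r < v -> distance_set Y v.
Proof.
move=> r0 [rho [rl _ rd]] [x [x' ->]] rv.
have [y xy] := rl x; have [y' xy'] := rl x'; exists y, y'.
exact/esym/(trunc_eq_gt r0 (rd _ _ _ _ xy xy')).
Qed.

Lemma coarse_isometric_gap s r X Y : s <= r -> coarse_isometric r X Y ->
  (forall v, distance_set X v \/ distance_set Y v -> v <= r -> v <= s) ->
  coarse_isometric s X Y.
Proof.
move=> sr [rho [rl rr rd]] gap; exists rho; split => // x y x' y' h h'.
have H v : (v <= r -> v <= s) -> trunc s v = trunc r v.
  have [vr /(_ isT) vs|rv _] := leP v r; first by rewrite !trunc_le.
  by rewrite !trunc_gt// (le_lt_trans sr).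
rewrite !H; first exact: rd.
- by apply: gap; right; exists y, y'.
- by apply: gap; left; exists x, x'.
Qed.

End CoarseIsometry.

Section CompactUltrametric.
Context {K : realType} (R : set K) (hR : range_set R).
Local Notation C := (compact_ultrametric_space R).
Implicit Types X Y : C.

Lemma cus_pseudo X : pseudo_ultrametric (@mdist K X).
Proof. by have [[[]]] := cus_ultrametric X. Qed.

Lemma cus_triangle X (x y z : X) : mdist x y <= Num.max (mdist x z) (mdist z y).
Proof. by have [_] := cus_pseudo X; apply. Qed.

Lemma cus_net X e : 0 < e -> exists l : seq X, forall y, exists2 z, z \in l & mdist z y < e.
Proof.
move=> e0; apply: totally_bounded (@cus_compact _ _ X) _ => x.
by have := nbhsx_ballx x e e0; rewrite ballEmdist.
Qed.

Lemma distance_set_thin X : thin (distance_set X).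
Proof.
move=> e e0; have e2 : 0 < e / 2 by lra.
have [l lP] := cus_net X e2.
apply: (@sub_finite_set _ _ ((fun p => mdist p.1 p.2) @` ([set` l] `*` [set` l]))).
  move=> _ [[x [y ->]] /= exy]; have [z zl zx] := lP x; have [w wl wy] := lP y.
  exists (z, w) => //=; apply: (@trunc_eq_gt _ (e / 2)); [exact: ltW| |lra].
  by apply: pseudo_ultrametric_trunc; rewrite ?ltW// 1?metric_sym//; exact: cus_pseudo.
by apply: finite_image; apply: finite_setX; exact: finite_seq.
Qed.

Lemma distance_set_R X : distance_set X `<=` R.
Proof. by move=> _ [x [y ->]]; have [_] := cus_ultrametric X; apply. Qed.

(** Choose maps [f n] and [g n] in both directions that are isometric up to
    [scale n] and inverse to each other up to [scale n]. Along an ultrafilter on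
    [nat], compactness gives pointwise limits [phi] and [psi]; these are exact
    isometries, and [phi (psi y) = y]. *)
Lemma coarse_isometric_isometric X Y :
  (forall e, 0 < e -> coarse_isometric e X Y) -> isometric X Y.
Proof.
move=> XY.
have /choice[rho rhoP] n := XY _ (@scale_gt0 K n).
have /choice[f fP] n : exists f : X -> Y, forall x, rho n x (f x).
  by have [/choice[h hP] _ _] := rhoP n; exists h.
have /choice[g gP] n : exists g : Y -> X, forall y, rho n (g y) y.
  by have [_ /choice[h hP] _] := rhoP n; exists h.
have rd n x y x' y' : rho n x y -> rho n x' y' ->
    trunc (scale n) (mdist x x') = trunc (scale n) (mdist y y').
  by case: (rhoP n) => _ _ +; apply.
have [U [UU Uoo]] := ultraFilterLemma (@eventually_filter).
have Uscale (e : K) : 0 < e -> U [set n | scale n < e].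
  move=> /scale_lt[n ne]; apply: Uoo; exists n => // k /= nk.
  by apply: le_lt_trans ne; exact: scale_le.
have ball_nbhs (Z : metricType K) (z : Z) e : 0 < e -> nbhs z [set w | mdist z w < e].
  by move=> e0; have := nbhsx_ballx z e e0; rewrite ballEmdist.
have /choice[phi phiP] x : exists y, forall e, 0 < e -> U [set n | mdist y (f n x) < e].
  have [y yP] := ultra_limit (fun n => f n x) UU (@cus_compact _ _ Y).
  by exists y => e e0; apply: (yP [set w | mdist y w < e]); exact: ball_nbhs.
have /choice[psi psiP] y : exists x, forall e, 0 < e -> U [set n | mdist x (g n y) < e].
  have [x xP] := ultra_limit (fun n => g n y) UU (@cus_compact _ _ X).
  by exists x => e e0; apply: (xP [set w | mdist x w < e]); exact: ball_nbhs.
exists phi.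
  move=> x x'; apply: trunc_sep; [exact: mdist_ge0|exact: mdist_ge0|move=> e e0].
  have [n [ne [nx nx']]] := filter_ex (filterI (Uscale e e0) (filterI (phiP x e e0) (phiP x' e e0))).
  rewrite (trunc_mono (scale_ge0 n) (ltW ne) (rd n _ _ _ _ (fP n x) (fP n x'))).
  by apply: pseudo_ultrametric_trunc; rewrite ?ltW//; exact: cus_pseudo.
apply/seteqP; split => // y _; exists (psi y) => //.
apply: mdist_positivity; apply: trunc_sep => // [|e e0]; first exact: mdist_ge0.
have [n [ne [nx ny]]] := filter_ex (filterI (Uscale e e0)
  (filterI (phiP (psi y) e e0) (psiP y e e0))).
rewrite trunc_at0 ?ltW//.
have -> : trunc e (mdist (phi (psi y)) y) = trunc e (mdist (f n (psi y)) y).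
  by apply: pseudo_ultrametric_trunc; rewrite ?mdistxx ?ltW//; exact: cus_pseudo.
rewrite -(trunc_mono (scale_ge0 n) (ltW ne) (rd n _ _ _ _ (fP n (psi y)) (gP n y))).
by rewrite trunc_le// ltW.
Qed.

Definition finite_space (T : finType) (t : T) (d : T -> T -> K)
    (du : ultrametric d) (dR : valued_in R d) : C.
Proof.
refine (@CompactUltrametric K R (metric_space du.1) _ _ _).
- by exists t.
- exact: (@finite_compact (metric_space du.1) setT (@finite_finset T setT)).
- by split.
Defined.

(** The distances of [X] are not affected by truncation at [r]: this is how the
    truncation of a space at level [r] is recognized. *)
Definition separated_space r X := forall x y : X, mdist x y = 0 \/ r < mdist x y.

(** The alternative [x = y] replaces an assumption on the sign of [r]. *)
Lemma separated_sublist r X (l : seq X) : exists l' : seq X,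
  [/\ uniq l', {in l' &, forall x y, x = y \/ r < mdist x y} &
      {in l, forall x, exists2 y, y \in l' & mdist x y <= r \/ x = y}].
Proof.
elim: l => [|a l [l' [ul' sl' ll']]]; first by exists [::].
have [[b bl' ab]|nb] := pselect (exists2 b, b \in l' & mdist a b <= r \/ a = b).
  exists l'; split => // x; rewrite inE => /predU1P[->|]; last exact: ll'.
  by exists b.
have far b : b \in l' -> r < mdist a b.
  by move=> bl'; rewrite ltNge; apply/negP => ab; apply: nb; exists b => //; left.
exists (a :: l'); split.
- rewrite /= ul' andbT; apply/negP => al'; apply: nb.
  by exists a => //; right.
- move=> x y; rewrite !inE => /predU1P[->|xl] /predU1P[->|yl]; first by left.
  + by right; exact: far.
  + by right; rewrite metric_sym; exact: far.
  + exact: sl'.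
- move=> x; rewrite inE => /predU1P[->|/ll'[y yl' xy]].
    by exists a; rewrite ?inE ?eqxx//; right.
  by exists y; rewrite // inE yl' orbT.
Qed.

(** A compact ultrametric space truncated at a positive level is finite. It is
    presented by a matrix of distances, which later serves to count isometry
    classes. *)
Lemma ord_net r X : 0 < r -> exists n (delta : nat -> nat -> K)
  (du : ultrametric (fun i j : 'I_n.+1 => delta i j))
  (dR : valued_in R (fun i j : 'I_n.+1 => delta i j)),
  coarse_isometric r X (finite_space ord0 du dR) /\
  separated_space r (finite_space ord0 du dR).
Proof.
move=> r0; have [x0 _] := @cus_nonempty _ _ X; have [l lP] := cus_net X r0.
have [l' [ul' sl' ll']] := separated_sublist r l.
have cover x : exists2 y, y \in l' & mdist x y <= r.
  have [z zl zx] := lP x; have [y yl' zy] := ll' z zl; exists y => //.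
  have {}zy : mdist z y <= r by case: zy => [//|->]; rewrite mdistxx ltW.
  by apply: (le_trans (cus_triangle _ _ z)); rewrite ge_max zy metric_sym ltW.
have l'0 : (0 < size l')%N by have [y] := cover x0; case: (l').
pose n := (size l').-1; have nE : n.+1 = size l' by rewrite prednK.
pose delta i j := mdist (nth x0 l' i) (nth x0 l' j).
have [[d0 dxx dsym dtri] ds] := cus_pseudo X.
have nth_l' (i : 'I_n.+1) : nth x0 l' i \in l' by rewrite mem_nth// -nE.
have du : ultrametric (fun i j : 'I_n.+1 => delta i j).
  split; last by move=> i j k; exact: ds.
  split; first by split=> *; [exact: d0|exact: dxx|exact: dsym|exact: dtri].
  move=> i j /mdist_positivity/eqP; rewrite nth_uniq//; try by rewrite -nE.
  by move/eqP/val_inj.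
have dR : valued_in R (fun i j : 'I_n.+1 => delta i j).
  by move=> i j; have [_] := cus_ultrametric X; apply.
exists n, delta, du, dR; split; last first.
  move=> i j; have [/= ij|] := sl' _ _ (nth_l' i) (nth_l' j); last by right.
  by left; apply: (etrans (congr1 (mdist^~ _) ij)); exact: dxx.
exists (fun x (i : 'I_n.+1) => mdist x (nth x0 l' i) <= r); split.
- move=> x; have [y yl' xy] := cover x.
  have iy : (index y l' < n.+1)%N by rewrite nE index_mem.
  by exists (Ordinal iy); rewrite -(nth_index x0 yl') in xy; exact: xy.
- by move=> i; exists (nth x0 l' (i : 'I_n.+1)); rewrite dxx ltW.
- move=> x i x' i' xi xi'; exact: pseudo_ultrametric_trunc (ltW r0) (cus_pseudo X) xi xi'.
Qed.

End CompactUltrametric.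

(** * Limits of compact ultrametric spaces *)

(** Let [N n] be a space that is separated at [scale n], and let [p] exhibit
    each [N n] as the truncation of [N n.+1]. Points of the limit are threads;
    along two threads the distances form a compatible sequence of truncations,
    and [trunc_limit] turns it into a distance. *)
Section InverseLimit.
Context {K : realType} (R : set K) (hR : range_set R).
Local Notation C := (compact_ultrametric_space R).

Context (N : nat -> C) (p : forall n, N n.+1 -> N n) (q : forall n, N n -> N n.+1).
Hypothesis Nsep : forall n, separated_space (scale n) (N n).
Hypothesis pE : forall n (y y' : N n.+1),
  mdist (p y) (p y') = trunc (scale n) (mdist y y').
Hypothesis pq : forall n (z : N n), p (q z) = z.

Definition thread : Type := {x : forall n, N n | forall n, p (x n.+1) = x n}.

Let trunc_dist n (x y : N n) : trunc (scale n) (mdist x y) = mdist x y.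
Proof.
by have [->|h] := Nsep x y; [rewrite trunc_at0// scale_ge0|rewrite trunc_gt].
Qed.

Lemma thread_dist_ex (x y : thread) : exists v, [/\ R v, 0 <= v &
  forall n, trunc (scale n) v = mdist (sval x n) (sval y n)].
Proof.
have [n|n|v [v0 vP] vn] := @trunc_limit K (fun n => mdist (sval x n) (sval y n)).
- exact: mdist_ge0.
- by rewrite -pE (svalP x) (svalP y).
exists v; split => //; case: vP => [->|[n ->]]; first exact: hR.2.
by have [_] := cus_ultrametric (N n); apply.
Qed.

Definition thread_dist x y : K := sval (cid (thread_dist_ex x y)).

Lemma thread_distP x y : [/\ R (thread_dist x y), 0 <= thread_dist x y &
  forall n, trunc (scale n) (thread_dist x y) = mdist (sval x n) (sval y n)].
Proof. exact: svalP (cid (thread_dist_ex x y)). Qed.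

Let D0 x y : 0 <= thread_dist x y. Proof. by case: (thread_distP x y). Qed.
Let DE x y n : trunc (scale n) (thread_dist x y) = mdist (sval x n) (sval y n).
Proof. by case: (thread_distP x y). Qed.

Let scale_sep (u v : K) : 0 <= u -> 0 <= v ->
  (forall n, trunc (scale n) u = trunc (scale n) v) -> u = v.
Proof.
move=> u0 v0 uv; apply: trunc_sep => // e /scale_lt[n ne].
exact: trunc_mono (scale_ge0 n) (ltW ne) (uv n).
Qed.

Lemma thread_ultrametric : ultrametric thread_dist.
Proof.
have ds : strong_triangle thread_dist.
  move=> x y z; rewrite leNgt; apply/negP => h.
  have /scale_lt[n nxy] : 0 < thread_dist x y by apply: le_lt_trans h; rewrite le_max D0.
  have le_trunc (v : K) : 0 <= v -> trunc (scale n) v <= v.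
    by rewrite /trunc; case: ifP.
  have := cus_triangle (sval x n) (sval y n) (sval z n).
  rewrite -!DE (trunc_gt nxy) leNgt => /negP; apply.
  by apply: le_lt_trans h; rewrite ge_max !le_max !le_trunc ?orbT.
split => //; split.
  split => // [x|x y|x y z].
  - by apply: scale_sep => // n; rewrite DE mdistxx trunc_at0// scale_ge0.
  - by apply: scale_sep => // n; rewrite !DE metric_sym.
  - by apply: (le_trans (ds x y z)); rewrite ge_max lerDl lerDr !D0.
move=> x y xy; apply: eq_sig_hprop; first by move=> *; exact: Prop_irrelevance.
apply: functional_extensionality_dep => n; apply: mdist_positivity.
by rewrite -[LHS]DE xy trunc_at0// scale_ge0.
Qed.

(** Follow [q] upwards and [p] downwards. The induction on [n] shifts the whole
    tower, which avoids transport between the types [N n]. *)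
Lemma thread_through n (z : N n) : exists x : thread, sval x n = z.
Proof.
suff [x [xp xn]] : exists x : forall n, N n, (forall n, p (x n.+1) = x n) /\ x n = z.
  by exists (exist _ x xp).
clear -pq.
elim: n N p q pq z => [|n IH] M r s rs z.
  pose x := fix x n := if n is m.+1 return M n then s m (x m) else z.
  by exists x; split => // n; exact: rs.
have [x [xp xn]] := IH (fun k => M k.+1) (fun k => @r k.+1) (fun k => @s k.+1) (fun k => @rs k.+1) z.
exists (fun k => if k is m.+1 return M k then x m else r 0%N (x 0%N)).
by split => // -[].
Qed.

Let L : metricType K := metric_space thread_ultrametric.1.

(** Along an ultrafilter each coordinate of a thread converges in [N n], hence
    is eventually constant because [N n] is separated; the eventual values form
    a thread, to which the ultrafilter converges. *)
Lemma thread_compact : compact [set: L].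
Proof.
rewrite compact_ultra => F UF _.
have aex n : exists a : N n, F [set x : thread | sval x n = a].
  have [a aP] := ultra_limit (fun x : thread => sval x n) UF (@cus_compact _ _ (N n)).
  have n0 := scale_gt0 (K := K) n.
  exists a; apply: filterS (aP _ (nbhsx_ballx a _ n0)) => x /=.
  rewrite ballEmdist /= => ax; apply/esym/mdist_positivity.
  by have [//|] := Nsep a (sval x n); rewrite ltNge (ltW ax).
pose a n := sval (cid (aex n)).
have aP n : F [set x : thread | sval x n = a n] by exact: svalP (cid (aex n)).
have ap n : p (a n.+1) = a n.
  have [x [<- <-]] := filter_ex (filterI (aP n) (aP n.+1)).
  exact: (svalP x).
exists (exist _ a ap : thread); split => // A; rewrite -nbhs_ballE => -[e /= e0 eA].
have [n ne] := scale_lt e0; apply: filterS (aP n) => x /= xa.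
apply: eA; rewrite ballEmdist /=; apply: le_lt_trans ne.
apply: trunc_eq0 (scale_ge0 n) _.
by rewrite [LHS]DE /= xa mdistxx.
Qed.

Lemma inverse_limit : exists X : C, forall n, coarse_isometric (scale n) (N n) X.
Proof.
have [z0 _] := @cus_nonempty _ _ (N 0%N); have [x0 _] := thread_through z0.
have Lu : ultrametric_space R L.
  by split; [exact: thread_ultrametric|move=> x y; case: (thread_distP x y)].
have L0 : [set: L] !=set0 by exists x0.
exists (CompactUltrametric L0 thread_compact Lu) => n.
exists (fun (z : N n) (x : thread) => sval x n = z); split.
- by move=> z; have [x xz] := thread_through z; exists x.
- by move=> x; exists (sval x n).
- by move=> _ x _ x' <- <-; rewrite trunc_dist; exact/esym/(DE x x' n).
Qed.

End InverseLimit.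

(** * Blowing up points to clusters *)
Section ClusterCopies.
Context {K : realType} (R : set K) (hR : range_set R).
Local Notation C := (compact_ultrametric_space R).
Context (r : K) (Rr : R r) (r0 : 0 < r).
Context (n : nat) (delta : nat -> nat -> K).
Context (du : ultrametric (fun i j : 'I_n.+1 => delta i j)).
Context (dR : valued_in R (fun i j : 'I_n.+1 => delta i j)).
Let N : C := finite_space ord0 du dR.
Hypothesis Nsep : separated_space r N.

(** Every point is replaced by a cluster of [k.+1] points at mutual distance
    [r]. *)
Let copies_dist k (x y : 'I_n.+1 * 'I_k.+1) : K :=
  Num.max (delta x.1 y.1) (if x == y then 0 else r).

Let d0 (i j : 'I_n.+1) : 0 <= delta i j. Proof. by case: du => -[[]]. Qed.
Let dxx (i : 'I_n.+1) : delta i i = 0. Proof. by case: du => -[[]]. Qed.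

Let copies_ultrametric k : ultrametric (@copies_dist k).
Proof.
have [[[_ _ dsym _] dpos] ds] := du.
have D0 (x y : 'I_n.+1 * 'I_k.+1) : 0 <= copies_dist x y by rewrite le_max d0.
have Ds : strong_triangle (@copies_dist k).
  move=> x y z; rewrite ge_max; apply/andP; split.
    by apply: (le_trans (ds x.1 y.1 z.1)); rewrite ge_max !le_max !lexx /= orbT.
  case: ifP => [_|xy]; first by rewrite le_max D0.
  rewrite !le_max; case: (eqVneq x z) => [xz|_]; last by rewrite lexx !orbT.
  by rewrite -xz xy lexx !orbT.
split => //; split.
  split => // [x|x y|x y z].
  - by rewrite /copies_dist eqxx dxx maxxx.
  - by rewrite /copies_dist dsym eq_sym.
  - by apply: (le_trans (Ds x y z)); rewrite ge_max lerDl lerDr !D0.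
move=> x y; rewrite /copies_dist; case: eqVneq => // _ h.
have : r <= 0 by rewrite -h le_max lexx orbT.
by rewrite leNgt r0.
Qed.

Let copies_valued k : valued_in R (@copies_dist k).
Proof.
move=> x y; rewrite /copies_dist; case: leP => _; last exact: dR.
by case: ifP => _ //; exact: hR.2.
Qed.

Let copies k : C := finite_space (ord0, ord0) (copies_ultrametric k) (@copies_valued k).

(** Clusters are the balls of radius [r], so an isometry maps a cluster into a
    single cluster, and the size of the clusters is an invariant. *)
Let copies_isometric_le k l : isometric (copies k) (copies l) -> (k <= l)%N.
Proof.
move=> [f f_iso _].
pose g (a : 'I_k.+1) : 'I_l.+1 := (f (ord0, a) : 'I_n.+1 * 'I_l.+1).2.
suff /leq_card : injective g by rewrite !card_ord.
move=> a b gab; apply/eqP; apply: contrapT => /negP ab.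
have dab : copies_dist (f (ord0, a)) (f (ord0, b)) = r.
  transitivity (@copies_dist k (ord0, a) (ord0, b)); first exact: f_iso.
  transitivity (Num.max 0 r); last by rewrite max_r// ltW.
  by congr Num.max; [exact: dxx|rewrite xpair_eqE eqxx (negPf ab)].
have fab : delta (f (ord0, a)).1 (f (ord0, b)).1 <= r by rewrite -dab le_max lexx.
have fst_eq : (f (ord0, a)).1 = (f (ord0, b)).1.
  have [[_ dpos] _] := du; apply: dpos.
  by have [//|] := Nsep (f (ord0, a)).1 (f (ord0, b)).1; rewrite ltNge fab.
move: dab; rewrite /copies_dist fst_eq dxx.
case: eqP => [_ /eqP|H _]; first by rewrite maxxx lt_eqF.
apply: H; move: fst_eq gab; rewrite /g.
by case: (f (ord0, a)) => ? ?; case: (f (ord0, b)) => ? ? /= -> ->.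
Qed.

Lemma cluster_copies : exists2 Y : nat -> C,
  forall k l, isometric (Y k) (Y l) -> (k <= l)%N &
  forall k, coarse_isometric r N (Y k) /\
    forall v, distance_set (Y k) v -> distance_set N v \/ v = r.
Proof.
exists copies => [|k]; first exact: copies_isometric_le.
have r0' := ltW r0; split.
  exists (fun (i : 'I_n.+1) (x : 'I_n.+1 * 'I_k.+1) => i = x.1); split.
  - by move=> i; exists (i, ord0).
  - by move=> x; exists (x : 'I_n.+1 * 'I_k.+1).1.
  - move=> _ x _ y -> ->; rewrite [mdist x y]/mdist /= /copies_dist trunc_max//.
    rewrite [X in Num.max _ X]trunc_le; last by case: ifP.
    by rewrite max_l// trunc_ge0.
move=> _ [x [y ->]]; rewrite [mdist x y]/mdist /= /copies_dist.
case: leP => _; last by left; exists (x : 'I_n.+1 * 'I_k.+1).1, (y : 'I_n.+1 * 'I_k.+1).1.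
case: ifP => _; last by right.
by left; exists ord0, ord0; rewrite [RHS]dxx.
Qed.

End ClusterCopies.

(** * Coarse isometries and the Gromov--Hausdorff distance *)
Section Gluing.
Context {K : realType} (R : set K) (hR : range_set R).
Local Notation C := (compact_ultrametric_space R).
Implicit Types X Y : C.

Lemma hausdorff_dist_le (Z : metricType K) (A B : set Z) r :
  A !=set0 -> B !=set0 ->
  (forall a, A a -> exists2 b, B b & mdist a b <= r) ->
  (forall b, B b -> exists2 a, A a & mdist b a <= r) -> hausdorff_dist A B <= r.
Proof.
move=> A0 B0 AB BA.
have aux (S T : set Z) : S !=set0 -> (forall a, S a -> exists2 b, T b & mdist a b <= r) ->
    sup [set dist_to_set (@mdist K Z) a T | a in S] <= r.
  move=> [s Ss] ST; apply: ge_sup; first by exists (dist_to_set (@mdist K Z) s T), s.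
  move=> _ [a /ST[b Tb ab] <-]; apply: le_trans ab; apply: ge_inf; last by exists b.
  by exists 0 => _ [t _ <-]; exact: mdist_ge0.
by rewrite ge_max !aux.
Qed.

(** In a common space, two points are related when they are at distance at most
    [e]. *)
Lemma coarse_of_embeddings X Y (Z : metricType K) (i : X -> Z) (j : Y -> Z) e :
  ultrametric_space R Z ->
  isometric_embedding (@mdist K X) (@mdist K Z) i ->
  isometric_embedding (@mdist K Y) (@mdist K Z) j ->
  hausdorff_dist (range i) (range j) < e -> 0 < e /\ coarse_isometric e X Y.
Proof.
move=> [[[Zp Zpos] Zs] ZR] i_iso j_iso.
have [x0 _] := @cus_nonempty _ _ X; have [y0 _] := @cus_nonempty _ _ Y.
rewrite gt_max => /andP[iX jY].
have ex (X' Y' : C) (i' : X' -> Z) (j' : Y' -> Z) (y' : Y') :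
    isometric_embedding (@mdist K X') (@mdist K Z) i' ->
    sup [set dist_to_set (@mdist K Z) a (range j') | a in range i'] < e ->
    forall x, exists y, mdist (i' x) (j' y) < e.
  move=> i'_iso supe x.
  suff xe : dist_to_set (@mdist K Z) (i' x) (range j') < e.
    have [|_ [_ [y _ <-] <-] xy] := inf_lt _ xe; last by exists y.
    by exists (mdist (i' x) (j' y')), (j' y') => //; exists y'.
  apply: le_lt_trans supe; apply: ub_le_sup; last by exists (i' x) => //; exists x.
  have [M MP] := thin_ubound (distance_set_thin X').
  exists (Num.max M (mdist (i' x) (j' y'))) => _ [_ [z _ <-] <-].
  apply: (@le_trans _ _ (mdist (i' z) (j' y'))).
    apply: ge_inf; last by exists (j' y') => //; exists y'.
    by exists 0 => _ [t _ <-]; exact: mdist_ge0.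
  apply: (le_trans (Zs _ _ (i' x))); rewrite ge_max !le_max lexx orbT andbT.
  by rewrite i'_iso MP//; exists z, x.
have e0 : 0 < e.
  have [y] := ex X Y i j y0 i_iso iX x0; exact: le_lt_trans (mdist_ge0 _ _).
split => //; exists (fun x y => mdist (i x) (j y) <= e); split.
- by move=> x; have [y xy] := ex X Y i j y0 i_iso iX x; exists y; exact: ltW.
- by move=> y; have [x yx] := ex Y X j i x0 j_iso jY y; exists x; rewrite metric_sym ltW.
- move=> x y x' y' h h'; rewrite -i_iso -j_iso.
  exact: pseudo_ultrametric_trunc (ltW e0) (conj Zp Zs) h h'.
Qed.

(** Conversely, put on the disjoint union the distance that sends [y] to a
    partner [c y] in [X] and then pays at least [r] for crossing. This needs
    [r > 0] to separate points. *)
Lemma gluing_space X Y r : R r -> 0 < r -> coarse_isometric r X Y ->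
  exists Z : metricType K, ultrametric_space R Z /\
    exists (i : X -> Z) (j : Y -> Z),
    [/\ isometric_embedding (@mdist K X) (@mdist K Z) i,
        isometric_embedding (@mdist K Y) (@mdist K Z) j &
        hausdorff_dist (range i) (range j) <= r].
Proof.
move=> Rr r0 [rho [rl rr rd]]; have r0' := ltW r0.
have /choice[c cP] := rr.
have [[X0 Xxx Xsym _] Xs] := cus_pseudo X; have [[Y0 Yxx Ysym _] Ys] := cus_pseudo Y.
have [_ XR] := cus_ultrametric X; have [_ YR] := cus_ultrametric Y.
(* c is an isometry above level r *)
have cYX y y' : mdist (c y) (c y') <= Num.max (mdist y y') r /\
    mdist y y' <= Num.max (mdist (c y) (c y')) r.
  by apply/trunc_eqP => //; exact: rd.
pose d (u v : X + Y) : K := match u, v with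
  | inl x, inl x' => mdist x x'
  | inl x, inr y => Num.max r (mdist x (c y))
  | inr y, inl x => Num.max r (mdist x (c y))
  | inr y, inr y' => mdist y y'
  end.
have d0 u v : 0 <= d u v by case: u v => ? [?|?] /=; rewrite ?le_max ?r0'.
have dsym u v : d u v = d v u by case: u v => ? [?|?] /=.
have ds : strong_triangle d.
  move=> [x|y] [x'|y'] [z|w] /=.
  - exact: Xs.
  - apply: (le_trans (Xs x x' (c w))); rewrite ge_max !le_max lexx /=.
    by rewrite (Xsym (c w)) lexx !orbT.
  - rewrite ge_max !le_max lexx !orbT /=.
    by have := Xs x (c y') z; rewrite !le_max => /orP[->|->]; rewrite ?orbT.
  - rewrite ge_max !le_max lexx /=.
    have := Xs x (c y') (c w); rewrite !le_max => /orP[->|h]; first by rewrite !orbT.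
    have := le_trans h (cYX w y').1; rewrite le_max => /orP[->|->]; by rewrite ?orbT.
  - rewrite ge_max !le_max lexx /=.
    by have := Xs x' (c y) z; rewrite (Xsym x' z) !le_max => /orP[->|->]; rewrite ?orbT.
  - rewrite ge_max !le_max lexx ?orbT /=.
    have := Xs x' (c y) (c w); rewrite !le_max => /orP[->|h]; first by rewrite !orbT.
    have := le_trans h (cYX w y).1; rewrite (Ysym w) le_max => /orP[->|->]; by rewrite ?orbT.
  - have := (cYX y y').2; rewrite !le_max => /orP[h|->]; last by rewrite ?orbT.
    have := le_trans h (Xs (c y) (c y') z); rewrite (Xsym (c y)) !le_max.
    by move=> /orP[->|->]; rewrite ?orbT.
  - exact: Ys.
have dm : is_metric d.
  split; first split=> // [[]//|u v w].
    by apply: (le_trans (ds u v w)); rewrite ge_max lerDl lerDr !d0.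
  have npos (x : X) y : Num.max r (mdist x (c y)) <> 0.
    by move=> h; have := r0; rewrite -h gt_max ltxx andFb.
  by move=> [x|y] [x'|y'] /= => [/mdist_positivity->|/npos|/npos|/mdist_positivity->].
exists (metric_space dm); split.
  split => // -[x|y] [x'|y'] /=; rewrite [mdist _ _]/mdist /=.
  - exact: XR.
  - by case: leP => _ //; exact: XR.
  - by case: leP => _ //; exact: XR.
  - exact: YR.
exists (inl : X -> X + Y), (inr : Y -> X + Y); split => //.
have near x y : rho x y -> mdist x (c y) <= r.
  move=> h; apply: (trunc_eq0 r0'); rewrite (rd _ _ _ _ h (cP y)).
  by rewrite Yxx trunc_at0.
have [x0 _] := @cus_nonempty _ _ X; have [y0 _] := @cus_nonempty _ _ Y.
apply: hausdorff_dist_le.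
- by exists (inl x0), x0.
- by exists (inr y0), y0.
- move=> _ [x _ <-]; have [y xy] := rl x; exists (inr y : X + Y); first by exists y.
  by rewrite [mdist _ _]/mdist /= ge_max lexx near.
- move=> _ [y _ <-]; exists (inl (c y) : X + Y); first by exists (c y).
  by rewrite [mdist _ _]/mdist /= ge_max lexx mdistxx.
Qed.

End Gluing.

(** * The space of isometry classes *)
Section GromovHausdorffPetaloid.
Context {K : realType} (R : set K) (hR : range_set R).
Local Notation C := (compact_ultrametric_space R).
Local Notation classes := (isometry_classes R).
Local Notation rep := (@representative K R).
Implicit Types (X Y : C) (A B : classes).

Lemma isometric_coarseP X Y :
  isometric X Y <-> forall e, 0 < e -> coarse_isometric e X Y.
Proof.
split=> [XY e _|]; first exact: isometric_coarse.
exact: coarse_isometric_isometric.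
Qed.

Lemma isometric_sym X Y : isometric X Y -> isometric Y X.
Proof.
move=> /isometric_coarseP XY; apply/isometric_coarseP => e /XY.
exact: coarse_isometric_sym.
Qed.

Lemma isometric_trans X Y (Z : C) : isometric X Y -> isometric Y Z -> isometric X Z.
Proof.
move=> /isometric_coarseP XY /isometric_coarseP YZ; apply/isometric_coarseP => e e0.
exact: coarse_isometric_trans (XY e e0) (YZ e e0).
Qed.

Definition class_of X : classes :=
  exist _ (fun Y : C => isometric X Y) (ex_intro _ X erefl).

Lemma sval_class A : sval A = fun Y : C => isometric (rep A) Y.
Proof. exact: svalP (cid (svalP A)). Qed.

Lemma class_eq A B : isometric (rep A) (rep B) -> A = B.
Proof.
move=> AB; apply: eq_sig_hprop; first by move=> *; exact: Prop_irrelevance.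
rewrite -[proj1_sig A]/(sval A) -[proj1_sig B]/(sval B) !sval_class.
apply/funext => Y; apply/propext; split; last exact: isometric_trans.
exact/isometric_trans/isometric_sym.
Qed.

Lemma rep_class X : isometric X (rep (class_of X)).
Proof.
have := congr1 (fun P : C -> Prop => P (rep (class_of X))) (sval_class (class_of X)).
move=> /= ->; apply/isometric_coarseP => e _; exact: coarse_isometric_refl.
Qed.

Let V A : set K := distance_set (rep A).
Let E r A B := coarse_isometric r (rep A) (rep B).

Let V_ge0 X v : distance_set X v -> 0 <= v.
Proof. by move=> /distance_set_R/hR.1. Qed.

Let V_zero X : distance_set X 0.
Proof. by have [x _] := @cus_nonempty _ _ X; exists x, x; rewrite mdistxx. Qed.

(* the nonzero distances of a class are those of any of its members *)
Let V_class X v : V (class_of X) v -> distance_set X v.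
Proof.
move=> Vv; have := V_ge0 Vv; rewrite le_eqVlt => /predU1P[<-|v0]; first exact: V_zero.
apply: coarse_distance_set (lexx 0) _ Vv v0.
exact/coarse_isometric_sym/isometric_coarse/rep_class.
Qed.

Let separated_sup X r v : separated_space r X -> distance_set X v -> v = 0 \/ r < v.
Proof. by move=> Xsep [x [y ->]]; exact: Xsep. Qed.

Lemma net_ex r X : 0 < r -> exists N : C, separated_space r N /\ coarse_isometric r X N.
Proof.
by move=> r0; have [n [delta [du [dR [? ?]]]]] := ord_net X r0; exists (finite_space ord0 du dR).
Qed.

(** Replace each space by its truncation [N n], which is the truncation of
    [N n.+1] up to isometry; the inverse limit of the [N n] is the limit. *)
Let complete (x : nat -> classes) : (forall n, E (scale n) (x n) (x n.+1)) ->
  exists y, forall n, E (scale n) (x n) y.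
Proof.
move=> xE.
have /choice[N NP] n : exists N : C, separated_space (scale n) N /\
    coarse_isometric (scale n) (rep (x n)) N by exact/net_ex/scale_gt0.
have pq_ex n : exists pq : (N n.+1 -> N n) * (N n -> N n.+1),
    (forall y y', mdist (pq.1 y) (pq.1 y') = trunc (scale n) (mdist y y')) /\
    (forall z, pq.1 (pq.2 z) = z).
  have n0 := @scale_ge0 K n.
  have [rho [rl rr rd]] : coarse_isometric (scale n) (N n) (N n.+1).
    apply: coarse_isometric_trans (coarse_isometric_sym (NP n).2) _.
    apply: coarse_isometric_trans (xE n) _.
    exact: coarse_isometric_le (scale_ge0 _) (scale_le (leqnSn n)) (NP n.+1).2.
  have sep_trunc (z z' : N n) : trunc (scale n) (mdist z z') = mdist z z'.
    by have [->|h] := (NP n).1 z z'; [rewrite trunc_at0|rewrite trunc_gt].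
  have /choice[p pP] := rr; have /choice[q qP] := rl.
  exists (p, q); split=> [y y'|z] /=.
    by rewrite -sep_trunc; exact: rd.
  apply: mdist_positivity; rewrite -sep_trunc (rd _ _ _ _ (pP (q z)) (qP z)).
  by rewrite mdistxx trunc_at0.
pose pq n := sval (cid (pq_ex n)).
have pqP n := svalP (cid (pq_ex n)).
have [L LP] := @inverse_limit K R hR N (fun n => (pq n).1) (fun n => (pq n).2)
  (fun n => (NP n).1) (fun n => (pqP n).1) (fun n => (pqP n).2).
exists (class_of L) => n.
apply: coarse_isometric_trans (NP n).2 _.
apply: coarse_isometric_trans (LP n) _.
exact/isometric_coarse/rep_class.
Qed.

(** At a level below all positive elements of [S], truncation is harmless and
    gives a finite space, whose class is determined by its size and its distance
    matrix with entries in the finite set [S]. *)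
Let countably_many S : finite_set S -> S `<=` R -> exists c : classes -> nat,
  forall A B, V A `<=` S -> V B `<=` S -> c A = c B -> A = B.
Proof.
move=> fS SR; have [s s0 sS] := finite_gap fS (fun v Sv => hR.1 v (SR v Sv)).
have s0' := ltW s0; move: fS => /finite_seqP[l lE].
have /choice[nd ndP] A : exists nd : nat * (nat -> nat -> K),
    exists (du : ultrametric (fun i j : 'I_nd.1.+1 => nd.2 i j))
      (dR : valued_in R (fun i j : 'I_nd.1.+1 => nd.2 i j)),
    coarse_isometric s (rep A) (finite_space ord0 du dR) /\
    separated_space s (finite_space ord0 du dR).
  have [n [delta [du [dR ?]]]] := ord_net (rep A) s0.
  by exists (n, delta), du, dR.
pose c A := ((nd A).1, [seq [seq index ((nd A).2 i j) l
  | j : 'I_(nd A).1.+1 <- enum 'I_(nd A).1.+1] | i : 'I_(nd A).1.+1 <- enum 'I_(nd A).1.+1]).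
exists (fun A => pickle (c A)) => A B AS BS /(pcan_inj pickleK).
have mem D : V D `<=` S -> forall i j, (i < (nd D).1.+1)%N -> (j < (nd D).1.+1)%N ->
    (nd D).2 i j \in l.
  move=> DS i j ilt jlt; suff : S ((nd D).2 i j) by rewrite lE.
  have [du [dR [cD sepD]]] := ndP D.
  have dij : distance_set (finite_space ord0 du dR) ((nd D).2 i j).
    by exists (Ordinal ilt), (Ordinal jlt).
  have [->|sd] := separated_sup sepD dij; first by apply/DS/V_zero.
  exact/DS/(coarse_distance_set s0' (coarse_isometric_sym cD) dij sd).
move: (mem A AS) (mem B BS); rewrite /c.
have [duA [dRA [cA _]]] := ndP A; have [duB [dRB [cB _]]] := ndP B.
move: duA dRA cA duB dRB cB.
case: (nd A) => n d; case: (nd B) => n' d' /= duA dRA cA duB dRB cB memA memB [nn'].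
subst n' => /eq_in_map dd'.
have AB : E s A B.
  apply: coarse_isometric_trans cA _.
  apply: coarse_isometric_trans (coarse_isometric_sym cB).
  exists (fun i j : 'I_n.+1 => i = j); split=> [i|i|i _ j _ <- <-].
  - by exists i.
  - by exists i.
  - congr trunc; rewrite [LHS]/mdist [RHS]/mdist /=.
    have /eq_in_map/(_ j) := dd' i (mem_enum _ i); rewrite mem_enum => /(_ isT) dij.
    by rewrite -[LHS](nth_index 0 (memA i j (ltn_ord i) (ltn_ord j))) dij nth_index// memB.
apply: class_eq; apply/isometric_coarseP => e e0.
apply: (coarse_isometric_le (lexx 0) (ltW e0)).
apply: (coarse_isometric_gap s0' AB) => v Vv vs.
have Sv : S v by case: Vv => [/AS|/BS].
by have [->//|] := sS v Sv; rewrite ltNge vs.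
Qed.

Let infinitely_many A r : R r -> 0 < r -> (forall v, V A v -> v = 0 \/ r < v) ->
  exists2 y : nat -> classes, (forall i j, y i = y j -> i = j) &
    forall i, E r A (y i) /\ (forall v, V (y i) v -> V A v \/ v = r).
Proof.
move=> Rr r0 Ar; have [n [delta [du [dR [AN Nsep]]]]] := ord_net (rep A) r0.
have [Y Yinj YP] := cluster_copies hR Rr r0 Nsep.
exists (fun k => class_of (Y k)) => [i j ij|k].
  have ijY : isometric (Y i) (Y j).
    apply: isometric_trans (rep_class _) _; rewrite ij.
    exact/isometric_sym/rep_class.
  by apply/eqP; rewrite eqn_leq !Yinj//; exact: isometric_sym.
have [NY Yv] := YP k; split.
  apply: coarse_isometric_trans AN _; apply: coarse_isometric_trans NY _.
  exact/isometric_coarse/rep_class.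
move=> v /V_class/Yv[Nv|]; last by right.
left; have [->|rv] := separated_sup Nsep Nv; first exact: V_zero.
exact: coarse_distance_set (ltW r0) (coarse_isometric_sym AN) Nv rv.
Qed.

Lemma NA_system : truncation_system R V E.
Proof.
split.
- have d0P : ultrametric (fun _ _ : unit => (0 : K)).
    split; last by move=> *; rewrite maxxx.
    by split=> [|[] []//]; split=> // *; rewrite addr0.
  have d0R : valued_in R (fun _ _ : unit => (0 : K)) by move=> *; exact: hR.2.
  by exists (class_of (finite_space tt d0P d0R)).
- by move=> A; exact: distance_set_R.
- by move=> A; exact: V_zero.
- by move=> A; exact: distance_set_thin.
- by move=> r A; exact: coarse_isometric_refl.
- by move=> r A B; exact: coarse_isometric_sym.
- by move=> r A B D _; exact: coarse_isometric_trans.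
- by move=> r s A B; exact: coarse_isometric_le.
- by move=> r A B v; exact: coarse_distance_set.
- move=> r A; rewrite le_eqVlt => /predU1P[<-|r0].
    exists A; first exact: coarse_isometric_refl.
    by move=> v /V_ge0; rewrite le_eqVlt => /predU1P[<-|]; [left|right].
  have [N [Nsep AN]] := net_ex (rep A) r0; exists (class_of N).
    exact: coarse_isometric_trans AN (isometric_coarse r (rep_class N)).
  by move=> v /V_class; exact: separated_sup.
- by move=> s r A B _; exact: coarse_isometric_gap.
- move=> r A B r0 ABr; exists (fun _ _ => True); split.
  + by have [y _] := @cus_nonempty _ _ (rep B); exists y.
  + by have [x _] := @cus_nonempty _ _ (rep A); exists x.
  + move=> x y x' y' _ _; rewrite !trunc_le//; apply: ABr.
      by right; exists y, y'.
    by left; exists x, x'.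
- by move=> A B AB; apply/class_eq/isometric_coarseP.
- exact: complete.
- exact: infinitely_many.
- exact: countably_many.
Qed.

(** No embedding can bring two classes closer than their least level of
    agreement by [coarse_of_embeddings]; gluing realizes that level when it is
    positive, and at level 0 the spaces are isometric. *)
Lemma NA_least A B r0 : R r0 -> 0 <= r0 ->
  (forall r, 0 <= r -> (r0 <= r <-> E r A B)) -> NA A B = r0.
Proof.
move=> Rr0 r0_ge0 r0P; rewrite /NA /NA_space; set H := [set r | _].
have low h : H h -> r0 <= h.
  move=> [Z [ZR [i [j [i_iso j_iso ->]]]]]; apply/ler_addgt0Pr => e e0.
  have [|h0 hAB] := coarse_of_embeddings (e := hausdorff_dist (range i) (range j) + e)
    ZR i_iso j_iso; first by rewrite ltrDl.
  by apply/r0P => //; exact: ltW.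
have [h Hh hr0] : exists2 h, H h & h <= r0.
  suff [Z [ZR [i [j [i_iso j_iso ijr]]]]] : exists Z : metricType K, ultrametric_space R Z /\
      exists (i : rep A -> Z) (j : rep B -> Z),
      [/\ isometric_embedding (@mdist K (rep A)) (@mdist K Z) i,
          isometric_embedding (@mdist K (rep B)) (@mdist K Z) j &
          hausdorff_dist (range i) (range j) <= r0].
    by exists (hausdorff_dist (range i) (range j)) => //; exists Z; split => //; exists i, j.
  have AB : E r0 A B by exact/r0P.
  move: r0_ge0; rewrite le_eqVlt => /predU1P[r00|r0_gt0]; last exact: gluing_space Rr0 r0_gt0 AB.
  have [f f_iso f_surj] : isometric (rep A) (rep B).
    apply/isometric_coarseP => e e0; rewrite /E -r00 in AB.
    exact: coarse_isometric_le (lexx 0) (ltW e0) AB.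
  have [x0 _] := @cus_nonempty _ _ (rep A).
  exists (rep B); split; first exact: cus_ultrametric.
  exists f, id; split => //; apply: hausdorff_dist_le.
  - by exists (f x0), x0.
  - by exists (f x0), (f x0).
  - by move=> b _; exists b; [exists b|rewrite mdistxx -r00].
  - move=> b _; exists b; last by rewrite mdistxx -r00.
    by rewrite f_surj.
apply/eqP; rewrite eq_le; apply/andP; split.
  by apply: (le_trans _ hr0); apply: ge_inf => //; exists r0.
by apply: lb_le_inf; first by exists h.
Qed.

Theorem NA_petaloid : petaloid R (@NA K R).
Proof.
have NAP A B : exists r0, [/\ NA A B = r0, 0 <= r0 &
    forall r, 0 <= r -> (r0 <= r <-> E r A B)].
  have [r0 [Rr0 r00 r0P]] := ts_least hR NA_system A B.
  by exists r0; split => //; exact: NA_least.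
apply: (petaloid_of_system hR NA_system) => A B; have [r0 [-> r00 r0P]] := NAP A B => //.
Qed.

End GromovHausdorffPetaloid.

(** * The four spaces *)
Theorem theorem1p3 (K : realType) (R : set K) (hR : range_set R)
    (uR : ~ countable R) :
  [/\ petaloid R (@C0_dist K R hR),
      forall X : topologicalType,
        compact [set: X] -> ultrametrizable K X ->
        (exists x : X, limit_point [set: X] x) ->
        petaloid R (@UD K X R),
      petaloid R (@NA K R)
    & petaloid R (@G_dist K R)].
Proof.
split.
- exact: C0_petaloid.
- move=> X cX uX [x xX]; have [b bP] := ultrametric_coordinates cX uX.
  exact: (Cpu_petaloid hR cX bP xX).
- exact: NA_petaloid.
- exact: G_petaloid.
Qed.
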